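(* Let $u$ be a nonconstant inner function and let $D_u$ be the dual compressed shift on $\mathcal{K}_u^\perp$. Then \[ m(D_u)=\begin{cases}0, & u(0)=0,\\ |u(0)|, & u(0)\neq 0,\end{cases} \] and in both cases $D_u$ attains its minimum modulus.
   Context: $L^2=L^2(\mathbb{T})$ with normalized Lebesgue measure on the unit circle $\mathbb{T}$; $H^2\subset L^2$ is the Hardy space, $H^2_-=L^2\ominus H^2=\overline{zH^2}$. An inner function is a bounded analytic function $u$ on the unit disc with $|u|=1$ a.e. on $\mathbb{T}$. The model space is $\mathcal{K}_u=H^2\ominus uH^2$, with orthogonal projection $P_{\mathcal{K}_u}$ of $L^2$ onto it; its orthogonal complement in $L^2$ is $\mathcal{K}_u^\perp=uH^2\oplus H^2_-$. The dual compressed shift is the operator $D_u:\mathcal{K}_u^\perp\to\mathcal{K}_u^\perp$, $D_uf=(I-P_{\mathcal{K}_u})(zf)$ (the dual truncated Toeplitz operator with symbol $\varphi(z)=z$; the subscript $u$ refers to the inner function, not the symbol). For a bounded operator $T$ on a Hilbert space $K$, $m(T)=\inf\{\|Tx\|:x\in K,\ \|x\|=1\}$, and $T$ attains its minimum modulus if $\|Tx_0\|=m(T)$ for some unit vector $x_0\in K$. *)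

(* Defs.v *)
From HB Require Import structures.
From mathcomp Require Import all_boot all_order all_algebra.
From mathcomp Require Import all_classical all_reals all_analysis.
From mathcomp Require Import complex.

Set Implicit Arguments.
Unset Strict Implicit.
Unset Printing Implicit Defensive.

Import Order.TTheory GRing.Theory Num.Theory.
Import numFieldNormedType.Exports.

Local Open Scope classical_set_scope.
Local Open Scope ring_scope.
Local Open Scope complex_scope.

(* The circle is parametrized by t |-> e^{it}, 0 <= t <= 2 pi, so that a complex
   function on the circle is represented by f : R -> R[i], of which only the
   values on [0, 2 pi] matter, and normalized Lebesgue measure is dt / (2 pi).
   Elements of L^2 are handled through their representatives: all the notions
   below that enter the theorem are invariant under a.e. equality.  The Lebesgue
   measure of the library lives on the Borel sets, hence representatives are
   Borel functions; this gives the same space of classes. *)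

Section Circle.
Variable R : realType.
Implicit Types (f g h p : R -> R[i]) (S : set (R -> R[i])).

Local Notation mu := (@lebesgue_measure R).

Definition angles : set R := `[0, 2 * pi]%classic.

Definition expi (t : R) : R[i] := cos t +i* sin t.

Definition circle_mean f : R[i] :=
  ((2 * pi)^-1 * \int[mu]_(t in angles) complex.Re (f t)) +i*
  ((2 * pi)^-1 * \int[mu]_(t in angles) complex.Im (f t)).

Definition L2 : set (R -> R[i]) := [set f : R -> R[i] |
  [/\ measurable_fun angles (fun t : R => complex.Re (f t)),
      measurable_fun angles (fun t : R => complex.Im (f t)) &
      mu.-integrable angles
        (fun t => (complex.Re (f t) ^+ 2 + complex.Im (f t) ^+ 2)%:E)]].

Definition inner f g : R[i] := circle_mean (fun t => f t * (g t)^*).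

Definition l2norm f : R := Num.sqrt (complex.Re (inner f f)).

Definition ae_eq_circle f g : Prop := {ae mu, forall t, angles t -> f t = g t}.

Definition orthocomplement S : set (R -> R[i]) :=
  [set f | L2 f /\ forall g, S g -> inner f g = 0].

(* A representative of the orthogonal projection of f onto S, for S a closed
   subspace of L2 and f in L2; it is unique up to a.e. equality. *)
Definition oproj S f : R -> R[i] :=
  xget (fun=> 0) [set p | S p /\ orthocomplement S (fun t => f t - p t)].

Definition fourier f (n : int) : R[i] := inner f (fun t => expi t ^ n).

Definition H2 : set (R -> R[i]) :=
  [set f | L2 f /\ forall n : int, n < 0 -> fourier f n = 0].

Definition disc : set R[i] := [set z | `|z| < 1].

(* [R[i]^o] is R[i] with the topology given by its norm. *)
Definition analytic_at (u : R[i] -> R[i]) (z0 : R[i]) : Prop :=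
  exists a : nat -> R[i], exists2 r : R, 0 < r &
    forall z, `|z - z0| < r%:C ->
      (fun N => \sum_(0 <= n < N) a n * (z - z0) ^+ n : R[i]^o) @ \oo
        --> (u z : R[i]^o).

Definition radial_limit (u : R[i] -> R[i]) (t : R) (w : R[i]) : Prop :=
  (u (r%:C * expi t) : R[i]^o) @[r --> 1^'-] --> (w : R[i]^o).

(* The values on the circle of a function u on the disc are its radial limits. *)
Definition inner_function (u : R[i] -> R[i]) : Prop :=
  [/\ forall z, disc z -> analytic_at u z,
      exists M : R, forall z, disc z -> `|u z| <= M%:C &
      {ae mu, forall t, angles t ->
         exists2 w, radial_limit u t w & `|w| = 1}].

Definition boundary (u : R[i] -> R[i]) (t : R) : R[i] :=
  xget 0 [set w | radial_limit u t w].

Definition nonconstant (u : R[i] -> R[i]) : Prop :=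
  ~ exists c, forall z, disc z -> u z = c.

Definition uH2 (u : R[i] -> R[i]) : set (R -> R[i]) :=
  [set f | L2 f /\
    exists2 h, H2 h & ae_eq_circle f (fun t => boundary u t * h t)].

Definition model_space (u : R[i] -> R[i]) : set (R -> R[i]) :=
  H2 `&` orthocomplement (uH2 u).

Definition model_space_perp (u : R[i] -> R[i]) : set (R -> R[i]) :=
  orthocomplement (model_space u).

Definition dual_compressed_shift (u : R[i] -> R[i]) f : R -> R[i] :=
  let zf := fun t => expi t * f t in
  fun t => zf t - oproj (model_space u) zf t.

Definition min_modulus S (T : (R -> R[i]) -> (R -> R[i])) : R :=
  inf [set l2norm (T f) | f in [set f | S f /\ l2norm f = 1]].

Definition attains_min_modulus S (T : (R -> R[i]) -> (R -> R[i])) : Prop :=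
  exists f, [/\ S f, l2norm f = 1 & l2norm (T f) = min_modulus S T].

End Circle.

(* Main.v *)
(* Write a = u(0) and let U be the boundary function of u, so |U| = 1 a.e.
   The only fact about u that is needed is: mean(U h) = a mean(h) for h in H^2.
   It gives k0 = 1 - conj(a) U in K_u, and conj(z) (k - k^(0)) in K_u for k in
   K_u.  Pairing f in K_u^perp with the latter shows <z f, k> = c conj(k^(0)) with
   c = <f, conj z>, and <k0, k> = conj(k^(0)); hence P_{K_u}(z f) = c k0 and
     |D_u f|^2 = |f|^2 - |c|^2 |k0|^2,   |k0|^2 = 1 - |a|^2.
   As |c| <= |f|, this is at least |a|^2 |f|^2, with equality at f = conj z.

   For the mean value fact, h is only known through its Fourier coefficients, so
   u(r .) is approximated uniformly on the circle by polynomials, obtained by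
   expanding the Cauchy kernel on a larger circle, and then r tends to 1 by
   dominated convergence.  Analyticity being local, Cauchy's formula is proved by
   differentiating in s the mean over t of u(w + s (rho e^{it} - w)) K(t), with
   K(t) = rho e^{it} / (rho e^{it} - w): the derivative in s is 1/s times the
   mean of a derivative in t of a periodic function. *)

Require Import Defs.
From mathcomp Require Import all_boot all_order all_algebra.
From mathcomp Require Import all_classical all_reals all_analysis.
From mathcomp Require Import measurable_realfun complex ring lra.
Import Order.TTheory GRing.Theory Num.Theory.
Import numFieldNormedType.Exports.
Set Implicit Arguments.
Unset Strict Implicit.
Unset Printing Implicit Defensive.
Local Open Scope classical_set_scope.
Local Open Scope ring_scope.
Local Open Scope complex_scope.

(** * Norm and limits of complex numbers *)

Section ComplexNorm.
Variable R : realType.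
Implicit Types (x y z w : R[i]).

Local Notation normc := (@Normc.normc R).
Local Notation Re := (@complex.Re R).
Local Notation Im := (@complex.Im R).

Lemma normr_normc z : `|z| = (normc z)%:C.
Proof. by []. Qed.

Lemma ReD x y : Re (x + y) = Re x + Re y. Proof. by case: x y => [? ?][]. Qed.
Lemma ImD x y : Im (x + y) = Im x + Im y. Proof. by case: x y => [? ?][]. Qed.
Lemma ReN x : Re (- x) = - Re x. Proof. by case: x. Qed.
Lemma ImN x : Im (- x) = - Im x. Proof. by case: x. Qed.
Lemma ReB x y : Re (x - y) = Re x - Re y. Proof. by rewrite ReD ReN. Qed.
Lemma ImB x y : Im (x - y) = Im x - Im y. Proof. by rewrite ImD ImN. Qed.
Lemma ReM x y : Re (x * y) = Re x * Re y - Im x * Im y.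
Proof. by case: x y => [? ?][]. Qed.
Lemma ImM x y : Im (x * y) = Re x * Im y + Im x * Re y.
Proof. by case: x y => [? ?][]. Qed.
Lemma ReJ x : Re x^* = Re x. Proof. by case: x. Qed.
Lemma ImJ x : Im x^* = - Im x. Proof. by case: x. Qed.

Lemma complexP x y : Re x = Re y -> Im x = Im y -> x = y.
Proof. by case: x y => [? ?][? ?] /= -> ->. Qed.

Lemma normc_ge0 z : 0 <= normc z.
Proof. by case: z => a b; exact: sqrtr_ge0. Qed.

Lemma normc_triangle x y : normc (x + y) <= normc x + normc y.
Proof. exact: le_normcD. Qed.

Lemma normc_opp x : normc (- x) = normc x.
Proof. exact: normcN. Qed.

Lemma normc_distC x y : normc (x - y) = normc (y - x).
Proof. by rewrite -normc_opp opprB. Qed.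

Lemma normc_sqr z : normc z ^+ 2 = Re z ^+ 2 + Im z ^+ 2.
Proof. by case: z => a b; rewrite sqr_sqrtr ?addr_ge0 ?sqr_ge0. Qed.

Lemma Re_le_normc z : `|Re z| <= normc z.
Proof.
by case: z => a b /=; rewrite -sqrtr_sqr ler_wsqrtr// lerDl sqr_ge0.
Qed.

Lemma Im_le_normc z : `|Im z| <= normc z.
Proof.
by case: z => a b /=; rewrite -sqrtr_sqr ler_wsqrtr// lerDr sqr_ge0.
Qed.

Lemma normc_le_ReIm z : normc z <= `|Re z| + `|Im z|.
Proof.
case: z => a b /=; rewrite -[leRHS]ger0_norm ?addr_ge0//.
rewrite -sqrtr_sqr ler_wsqrtr// sqrrD !real_normK ?num_real//.
by rewrite lerD2r lerDl mulrn_wge0// mulr_ge0.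
Qed.

Lemma normc_real (a : R) : normc a%:C = `|a|.
Proof. by rewrite /= expr0n addr0 sqrtr_sqr. Qed.

Lemma normc_exp z n : normc (z ^+ n) = normc z ^+ n.
Proof.
elim: n => [|n IH]; first by rewrite !expr0 Normc.normc1.
by rewrite !exprS Normc.normcM IH.
Qed.

Lemma normc_sum (I : Type) (r : seq I) (P : pred I) (f : I -> R[i]) :
  normc (\sum_(i <- r | P i) f i) <= \sum_(i <- r | P i) normc (f i).
Proof.
elim/big_rec2: _ => [|i y x _ h]; first by rewrite Normc.normc0.
exact: le_trans (normc_triangle _ _) (lerD _ _).
Qed.

Lemma normc_lt z (e : R) : (`|z| < e%:C) = (normc z < e).
Proof. exact: ltcR. Qed.

Lemma cvgc_normP (T : Type) (F : set_system T) (FF : Filter F)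
    (f : T -> R[i]) (l : R[i]) :
  (f x : R[i]^o) @[x --> F] --> (l : R[i]^o) <->
  forall e : R, 0 < e -> \forall x \near F, normc (f x - l) < e.
Proof.
split=> [/cvgrPdist_lt H e e0|H].
  have /H : 0 < e%:C :> R[i] by rewrite ltcR.
  by apply: filterS => x; rewrite normc_lt normc_distC.
(* A positive element of R[i] is real: [e'] vanishes and the bound becomes one over the reals. *)
apply/cvgrPdist_lt => -[e e'] /=; rewrite ltcE/= => /andP[/eqP -> e0].
by apply: filterS (H e e0) => x; rewrite normc_distC -normc_lt.
Qed.

(** Reduces complex limits to real ones, so that theorems on real derivatives and integrals can be
    applied to complex functions. *)
Lemma cvgcP (T : Type) (F : set_system T) (FF : Filter F)
    (f : T -> R[i]) (l : R[i]) :
  (f x : R[i]^o) @[x --> F] --> (l : R[i]^o) <->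
  Re (f x) @[x --> F] --> Re l /\ Im (f x) @[x --> F] --> Im l.
Proof.
split=> [/cvgc_normP H|[H1 H2]].
  split; apply/cvgrPdist_lt => e e0; near=> x.
    rewrite distrC; apply: (@le_lt_trans _ _ (normc (f x - l))).
      rewrite -ReB; exact: Re_le_normc.
    by near: x; exact: H.
  rewrite distrC; apply: (@le_lt_trans _ _ (normc (f x - l))).
    rewrite -ImB; exact: Im_le_normc.
  by near: x; exact: H.
apply/cvgc_normP => e e0; near=> x.
apply: le_lt_trans (normc_le_ReIm _) _.
rewrite ReB ImB (splitr e) ltrD//.
  rewrite distrC; near: x; move/cvgrPdist_lt: H1; apply; lra.
rewrite distrC; near: x; move/cvgrPdist_lt: H2; apply; lra.
Unshelve. all: by end_near. Qed.

Lemma cvg_normc (T : Type) (F : set_system T) (FF : Filter F)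
    (f : T -> R[i]) (l : R[i]) :
  (f x : R[i]^o) @[x --> F] --> (l : R[i]^o) ->
  normc (f x) @[x --> F] --> normc l.
Proof.
move/cvgc_normP => H; apply/cvgrPdist_lt => e e0; near=> x.
apply: (@le_lt_trans _ _ (normc (f x - l))); last by near: x; exact: H.
rewrite ler_norml; apply/andP; split.
  have := normc_triangle (f x - l) l; rewrite subrK; lra.
have := normc_triangle (l - f x) (f x); rewrite subrK normc_distC; lra.
Unshelve. all: by end_near. Qed.

End ComplexNorm.

(** * Local power series are continuously differentiable *)

Section AnalyticC1.
Variable R : realType.
Implicit Types (w z : R[i]) (u : R[i] -> R[i]).

Local Notation normc := (@Normc.normc R).
Local Notation Re := (@complex.Re R).
Local Notation Im := (@complex.Im R).

Lemma normc_natr n : normc n%:R = n%:R :> R.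
Proof. by rewrite (_ : n%:R = (n%:R : R)%:C) ?normc_real ?normr_nat ?rmorph_nat. Qed.

(** Induction on n: the remainder satisfies e(n+1) = w e(n) + n z^(n-1) (w - z)^2. The factor r^2 on
    the left replaces an exponent n - 2 on the right, which would be truncated for n < 2. *)
Lemma power_taylor1 (r : R) w z n : normc w <= r -> normc z <= r ->
  r ^+ 2 * normc (w ^+ n - z ^+ n - (w - z) * (n%:R * z ^+ n.-1)) <=
  n%:R ^+ 2 * r ^+ n * normc (w - z) ^+ 2.
Proof.
move=> wr zr; have r0 : 0 <= r by exact: le_trans (normc_ge0 z) zr.
elim: n => [|n IH].
  by rewrite !expr0 subrr !mul0r mulr0 subr0 Normc.normc0 mulr0 expr0n !mul0r.
pose e n := w ^+ n - z ^+ n - (w - z) * (n%:R * z ^+ n.-1).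
have -> : w ^+ n.+1 - z ^+ n.+1 - (w - z) * (n.+1%:R * z ^+ n.+1.-1) =
    w * e n + n%:R * z ^+ n.-1 * (w - z) ^+ 2.
  rewrite /e; case: n {IH} => [|n] /=.
    by rewrite !expr0 !mul0r; ring.
  by rewrite [(n.+2)%:R]mulrS !exprS; ring.
apply: le_trans (ler_wpM2l (sqr_ge0 r) (normc_triangle _ _)) _.
rewrite !Normc.normcM !normc_exp normc_natr.
set D := normc (w - z); set E := normc (e n).
have H1 : r ^+ 2 * (normc w * E) <= r * (n%:R ^+ 2 * r ^+ n * D ^+ 2).
  rewrite mulrCA; apply: ler_pM => //; first exact: normc_ge0.
  by rewrite mulr_ge0 ?sqr_ge0 ?normc_ge0.
have H2 : r ^+ 2 * (n%:R * normc z ^+ n.-1 * D ^+ 2) <= n%:R * r ^+ n.+1 * D ^+ 2.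
  case: n {IH H1 E} => [|n] /=; first by rewrite !mul0r mulr0.
  have -> : n.+1%:R * r ^+ n.+2 * D ^+ 2 = r ^+ 2 * (n.+1%:R * r ^+ n * D ^+ 2).
    by rewrite !exprS; ring.
  apply: ler_wpM2l; first exact: sqr_ge0.
  apply: ler_wpM2r; first exact: sqr_ge0.
  by apply: ler_wpM2l => //; rewrite lerXn2r ?nnegrE ?normc_ge0.
rewrite mulrDr; apply: le_trans (lerD H1 H2) _.
have -> : n.+1%:R ^+ 2 * r ^+ n.+1 * D ^+ 2 =
   r * (n%:R ^+ 2 * r ^+ n * D ^+ 2) + n%:R * r ^+ n.+1 * D ^+ 2
   + (n%:R + 1) * r ^+ n.+1 * D ^+ 2.
  by rewrite mulrS !exprS; ring.
by rewrite lerDl mulr_ge0 ?sqr_ge0// mulr_ge0 ?exprn_ge0// addr_ge0.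
Qed.

Lemma sqr_le_exp4 n : (n%:R ^+ 2 <= 4 ^+ n :> R).
Proof.
have -> : 4 = 2 ^+ 2 :> R by ring.
rewrite exprAC lerXn2r ?nnegrE ?exprn_ge0 ?ler0n//.
by rewrite -natrX ler_nat ltnW// ltn_expl.
Qed.

Lemma cvg_series_geometric_bound (v : R^nat) (K : R) :
  (forall n, `|v n| <= K * 2^-1 ^+ n) -> cvgn (series v).
Proof.
move=> H; apply: normed_cvg.
apply: (@series_le_cvg _ _ (geometric K 2^-1)) => [n|n|n|].
- exact: normr_ge0.
- exact: le_trans (normr_ge0 _) (H n).
- exact: H.
- by apply: is_cvg_geometric_series; rewrite ger0_norm; lra.
Qed.

Lemma sum_geometric_bound (K : R) N : 0 <= K ->
  \sum_(0 <= n < N) (K * 2^-1 ^+ n) <= 2 * K.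
Proof.
move=> K0; have -> : \sum_(0 <= n < N) (K * 2^-1 ^+ n) = 2 * K * (1 - 2^-1 ^+ N).
  elim: N => [|N IH]; first by rewrite big_nil expr0 subrr mulr0.
  by rewrite big_nat_recr//= IH exprS; field.
rewrite -[leRHS]mulr1 ler_wpM2l ?mulr_ge0// gerBl exprn_ge0// invr_ge0; lra.
Qed.

(** The base point z varies over a whole disc with one constant C, so the estimate gives both
    differentiability and, by exchanging w and z, a Lipschitz bound for the derivative. It comes
    from summing [power_taylor1] over the series. *)
Lemma analytic_taylor1 u z0 : analytic_at u z0 ->
  exists2 r : R, 0 < r & exists (C : R) (d : R[i] -> R[i]), forall w z,
    normc (w - z0) < r -> normc (z - z0) < r ->
    normc (u w - u z - (w - z) * d z) <= C * normc (w - z) ^+ 2.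
Proof.
case=> a [r0 r0_gt0 Hu].
pose r1 := r0 / 2; have r1_gt0 : 0 < r1 by rewrite /r1; lra.
(* The series converges at z0 + r1, so its terms there are bounded. *)
have [M M0 HM] : exists2 M : R, 0 <= M & forall n, normc (a n) * r1 ^+ n <= M.
  have /Hu h : `|z0 + r1%:C - z0| < r0%:C.
    by rewrite addrC addKr normc_lt normc_real gtr0_norm// /r1; lra.
  have cv : cvgn (series (fun n => a n * (z0 + r1%:C - z0) ^+ n : R[i]^o)).
    by apply/cvg_ex; exists (u (z0 + r1%:C)); exact: h.
  have := cvg_seq_bounded (cvgP _ (cvg_series_cvg_0 cv)).
  case=> B [Breal /(_ (B + 1))]; rewrite ltrDl ltr01 => /(_ isT).
  case: (B + 1) => M M' HM; exists `|M|; rewrite ?normr_ge0// => n.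
  have := HM n I; rewrite /= addrC addKr normr_normc Normc.normcM.
  rewrite normc_exp normc_real.
  rewrite gtr0_norm// lecE /= => /andP[_ h1].
  by rewrite (le_trans h1)// ler_norm.
(* Dividing by 8 absorbs the factor n^2: n^2 / 8^n <= 4^n / 8^n = 2^-n. *)
pose r := r1 / 8; have r_gt0 : 0 < r by rewrite /r; lra.
have Hn n : normc (a n) * (n%:R ^+ 2 * r ^+ n) <= M * 2^-1 ^+ n.
  rewrite /r expr_div_n mulrCA [_ / _]mulrC [normc _ * _]mulrCA mulrA.
  rewrite [leLHS](_ : _ = (n%:R ^+ 2 / 8 ^+ n) * (normc (a n) * r1 ^+ n)); last by ring.
  rewrite [leRHS]mulrC; apply: ler_pM => //.
  - by rewrite mulr_ge0 ?normc_ge0 ?exprn_ge0// ltW.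
  rewrite ler_pdivrMr ?exprn_gt0//.
  rewrite -exprMn (_ : 2^-1 * 8 = 4); first exact: sqr_le_exp4.
  by field.
pose b (z : R[i]) n := a n * (n%:R * (z - z0) ^+ n.-1).
have Hb z n : normc (z - z0) < r -> normc (b z n) <= M / r * 2^-1 ^+ n.
  move=> /ltW zr; rewrite mulrAC ler_pdivlMr//; apply: le_trans (Hn n).
  rewrite /b !Normc.normcM normc_exp normc_natr -mulrA.
  apply: ler_wpM2l; first exact: normc_ge0.
  case: n => [|n]; first by rewrite !mul0r expr0n mul0r.
  rewrite -mulrA exprS /= [r ^+ _]exprSr expr1 -mulrA; apply: ler_wpM2l => //.
  rewrite -[leLHS]mul1r; apply: ler_pM => //.
  - by rewrite mulr_ge0 ?exprn_ge0 ?normc_ge0// ltW.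
  - by rewrite ler1n.
  by apply: ler_wpM2r; [exact: ltW|rewrite lerXn2r ?nnegrE ?normc_ge0// ltW].
(* The series differentiated term by term; its sum is taken on real and imaginary parts, where
   comparison with a geometric series applies. *)
pose d z := limn (series (fun n => Re (b z n))) +i* limn (series (fun n => Im (b z n))).
have Hd z : normc (z - z0) < r ->
    (series (b z) N : R[i]^o) @[N --> \oo] --> (d z : R[i]^o).
  move=> zr; apply/cvgcP; split => /=.
    have -> : (fun N => Re (series (b z) N)) = series (fun n => Re (b z n)).
      apply/funext => N; rewrite /series/=.
      by elim/big_ind2: _ => // x1 ? x2 ? <- <-; rewrite ReD.
    apply: cvg_series_geometric_bound (M / r) _ => n.
    by rewrite (le_trans (Re_le_normc _))// Hb.
  have -> : (fun N => Im (series (b z) N)) = series (fun n => Im (b z n)).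
    apply/funext => N; rewrite /series/=.
    by elim/big_ind2: _ => // x1 ? x2 ? <- <-; rewrite ImD.
  apply: cvg_series_geometric_bound (M / r) _ => n.
  by rewrite (le_trans (Im_le_normc _))// Hb.
exists r => //; exists (2 * M / r ^+ 2), d => w z wr zr.
pose P z N : R[i]^o := \sum_(0 <= n < N) a n * (z - z0) ^+ n.
have rr0 : r < r0 by rewrite /r /r1; lra.
have HP z' : normc (z' - z0) < r -> P z' N @[N --> \oo] --> (u z' : R[i]^o).
  by move=> h; apply: Hu; rewrite normc_lt (lt_trans h).
have cvE : (P w N - P z N - (w - z : R[i]^o) * (series (b z) N : R[i]^o) : R[i]^o)
    @[N --> \oo] --> (u w - u z - (w - z) * d z : R[i]^o).
  apply: cvgB; first by apply: cvgB; exact: HP.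
  by apply: cvgM; [exact: cvg_cst|exact: Hd].
(* The bound is proved for partial sums, uniformly in N, and passes to the limit. *)
apply: cvgr_to_le (cvg_normc _ cvE) _; apply: nearW => N.
rewrite /P /series /= -!sumrB mulr_sumr -sumrB.
apply: le_trans (normc_sum _ _ _) _.
have -> : 2 * M / r ^+ 2 * normc (w - z) ^+ 2 =
  2 * (M * (r ^+ 2)^-1 * normc (w - z) ^+ 2) by ring.
apply: le_trans (sum_geometric_bound N _); last first.
  by rewrite mulr_ge0 ?sqr_ge0// divr_ge0// sqr_ge0.
apply: ler_sum => n _; rewrite /b.
have -> : a n * (w - z0) ^+ n - a n * (z - z0) ^+ n -
    (w - z) * (a n * (n%:R * (z - z0) ^+ n.-1)) =
    a n * ((w - z0) ^+ n - (z - z0) ^+ n -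
      ((w - z0) - (z - z0)) * (n%:R * (z - z0) ^+ n.-1)) by ring.
rewrite Normc.normcM.
have -> : M / r ^+ 2 * normc (w - z) ^+ 2 * 2^-1 ^+ n =
   (M * 2^-1 ^+ n) * normc (w - z) ^+ 2 / r ^+ 2 by ring.
rewrite ler_pdivlMr ?exprn_gt0// [leLHS]mulrC mulrCA.
apply: le_trans (ler_wpM2l (normc_ge0 _) (power_taylor1 n (ltW wr) (ltW zr))) _.
rewrite (_ : w - z0 - (z - z0) = w - z); last by ring.
rewrite [leLHS]mulrA; apply: ler_wpM2r (Hn n); exact: sqr_ge0.
Qed.

Lemma near_normc z (e : R) : 0 < e ->
  \forall x \near (z : R[i]^o), normc (x - z) < e.
Proof.
have /(cvgc_normP (nbhs_filter (z : R[i]^o)) id z) H :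
  (x : R[i]^o) @[x --> (z : R[i]^o)] --> (z : R[i]^o) by exact: cvg_id.
exact: H.
Qed.

(** At w = z + e with e > 0 real, the two expansions give |d1 - d2| <= (C1 + C2) e, which fails for
    small e unless d1 = d2. *)
Lemma taylor1_uniq (r C1 C2 : R) z u d1 d2 : 0 < r ->
  (forall w, normc (w - z) < r ->
     normc (u w - u z - (w - z) * d1) <= C1 * normc (w - z) ^+ 2) ->
  (forall w, normc (w - z) < r ->
     normc (u w - u z - (w - z) * d2) <= C2 * normc (w - z) ^+ 2) -> d1 = d2.
Proof.
move=> r0 H1 H2; apply/eqP; rewrite -subr_eq0; apply/negP => /negP d12.
have D0 : 0 < normc (d1 - d2).
  by rewrite lt_neqAle normc_ge0 andbT eq_sym; apply: contra d12 => /eqP/Normc.eq0_normc ->.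
pose K := `|C1 + C2| + 1; have K0 : 0 < K by rewrite ltr_wpDl.
(* The bound r / 2 keeps z + e in the disc; the other one makes K e at most half of |d1 - d2|. *)
pose e := Num.min (r / 2) (normc (d1 - d2) / (2 * K)).
have e0 : 0 < e by rewrite lt_min !divr_gt0//; lra.
have eN : normc e%:C = e by rewrite normc_real gtr0_norm.
have er : normc (z + e%:C - z) < r.
  by rewrite addrC addKr eN gt_min; apply/orP; left; lra.
have := lerD (H2 _ er) (H1 _ er); rewrite -[in X in X + _ <= _]normc_opp.
move=> /(le_trans (normc_triangle _ _)); rewrite [z + _]addrC addrK eN.
have -> : - (u (e%:C + z) - u z - e%:C * d2) + (u (e%:C + z) - u z - e%:C * d1) =
   - (e%:C * (d1 - d2)) by ring.
rewrite normc_opp Normc.normcM eN -mulrDl expr2 mulrCA [_ + C1]addrC ler_pM2l//.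
rewrite leNgt => /negP; apply.
apply: (@le_lt_trans _ _ (K * e)).
  by rewrite ler_wpM2r ?(ltW e0)// (le_trans (ler_norm _))// lerDl.
have : e <= normc (d1 - d2) / (2 * K) by rewrite ge_min lexx orbT.
rewrite ler_pdivlMr ?mulr_gt0// => h.
apply: le_lt_trans (_ : normc (d1 - d2) / 2 < _); lra.
Qed.

(* Differentiability is in Caratheodory's form. *)
Definition complex_C1 u (du : R[i] -> R[i]) := forall z, disc z ->
  {for z, continuous (du : R[i]^o -> R[i]^o)} /\
  exists phi : R[i] -> R[i], [/\ forall x, u x - u z = phi x * (x - z),
    {for z, continuous (phi : R[i]^o -> R[i]^o)} & phi z = du z].

(** The local derivatives of [analytic_taylor1] are glued by choice: du z is the value at z of the
    one built around z. By [taylor1_uniq], du agrees near z with that single local function, whose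
    continuity at z it inherits. *)
Lemma analytic_C1 u : (forall z, disc z -> analytic_at u z) ->
  exists du, complex_C1 u du.
Proof.
move=> anu.
have lin (K : R) : forall e, 0 < e -> exists2 d : R, 0 < d & forall t, 0 <= t < d -> K * t < e.
  move=> e e0; exists (e / (`|K| + 1)); first by rewrite divr_gt0// ltr_wpDl.
  move=> t /andP[t0]; rewrite ltr_pdivlMr ?ltr_wpDl// => h.
  apply: le_lt_trans h; rewrite mulrC ler_wpM2l//.
  by rewrite (le_trans (ler_norm K))// lerDl.
have carath (C : R) d r z : 0 < r -> (forall w, normc (w - z) < r ->
    normc (u w - u z - (w - z) * d) <= C * normc (w - z) ^+ 2) ->
    exists phi : R[i] -> R[i], [/\ forall x, u x - u z = phi x * (x - z),
    {for z, continuous (phi : R[i]^o -> R[i]^o)} & phi z = d].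
  (* The difference quotient, completed at x = z by its limit d. *)
  move=> r0 H; exists (fun x => if x == z then d else (u x - u z) / (x - z)).
  split; last by rewrite eqxx.
    move=> x; case: eqP => [->|/eqP xz]; first by rewrite !subrr mulr0.
    by rewrite divfK// subr_eq0.
  apply/(cvgc_normP (nbhs_filter (z : R[i]^o))) => e e0; rewrite /= eqxx.
  have [dl dl0 Hdl] := lin C _ e0.
  have : \forall x \near (z : R[i]^o), normc (x - z) < Num.min r dl.
    by apply: near_normc; rewrite lt_min r0.
  apply: filterS => x; rewrite lt_min => /andP[xr xd].
  case: eqP => [_|/eqP xz]; first by rewrite subrr Normc.normc0.
  have nz : x - z != 0 by rewrite subr_eq0.
  have nz' : 0 < normc (x - z).
    by rewrite lt_neqAle normc_ge0 andbT eq_sym; apply: contra nz => /eqP/Normc.eq0_normc ->.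
  have -> : (u x - u z) / (x - z) - d = (u x - u z - (x - z) * d) / (x - z).
    by field.
  rewrite Normc.normcM Normc.normcV; apply: (@le_lt_trans _ _ (C * normc (x - z))).
    by rewrite ler_pdivrMr// -mulrA -expr2 H.
  by apply: Hdl; rewrite normc_ge0.
have [du Hdu] : {du : R[i] -> R[i] & forall z, disc z -> exists2 r : R, 0 < r &
    exists (C : R) (d : R[i] -> R[i]), d z = du z /\ forall w z',
    normc (w - z) < r -> normc (z' - z) < r ->
    normc (u w - u z' - (w - z') * d z') <= C * normc (w - z') ^+ 2}.
  apply: (@choice _ _ (fun z c => disc z -> exists2 r : R, 0 < r &
    exists (C : R) (d : R[i] -> R[i]), d z = c /\ forall w z',
    normc (w - z) < r -> normc (z' - z) < r ->
    normc (u w - u z' - (w - z') * d z') <= C * normc (w - z') ^+ 2)) => z.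
  have [zd|zd] := pselect (disc z); last by exists 0.
  have [r r0 [C [d Hd]]] := analytic_taylor1 (anu z zd).
  by exists (d z) => _; exists r => //; exists C, d.
exists du => z zd; have [r r0 [C [d [dz Hd]]]] := Hdu z zd.
have dE z' : disc z' -> normc (z' - z) < r -> du z' = d z'.
  move=> zd' zr'.
  have [r' r0' [C' [d' [<- Hd']]]] := Hdu z' zd'.
  (* On a disc of this radius around z', the expansions coming from z' and from z both hold. *)
  apply: (@taylor1_uniq (Num.min r' (r - normc (z' - z))) C' C z') => [|w|w].
  - by rewrite lt_min r0' subr_gt0.
  - by rewrite lt_min => /andP[wr' _]; apply: Hd'; rewrite ?subrr ?Normc.normc0.
  rewrite lt_min => /andP[_ wr]; apply: Hd => //.
  rewrite (_ : w - z = (w - z') + (z' - z)); last by ring.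
  by rewrite (le_lt_trans (normc_triangle _ _))// -ltrBrDr.
split; last first.
  rewrite -dz; apply: (@carath C _ r) => // w wr; apply: Hd => //.
  by rewrite subrr Normc.normc0.
apply/(cvgc_normP (nbhs_filter (z : R[i]^o))) => e e0; rewrite -dz.
have [dl dl0 Hdl] := lin (2 * C) _ e0.
have : \forall x \near (z : R[i]^o), normc (x - z) < Num.min (Num.min r dl) (1 - normc z).
  by apply: near_normc; rewrite !lt_min r0 dl0 /= subr_gt0 -normc_lt.
apply: filterS => x; rewrite !lt_min => /andP[/andP[xr xd] xz].
rewrite dE//; last first.
  rewrite /disc /= normc_lt (_ : x = (x - z) + z); last by ring.
  by rewrite (le_lt_trans (normc_triangle _ _))// -ltrBrDr.
have [->|xNz] := eqVneq x z; first by rewrite subrr Normc.normc0.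
have nz' : 0 < normc (x - z).
  rewrite lt_neqAle normc_ge0 andbT eq_sym.
  by apply: contra xNz => /eqP/Normc.eq0_normc/eqP; rewrite subr_eq0.
apply: (@le_lt_trans _ _ (2 * C * normc (x - z))); last by apply: Hdl; rewrite normc_ge0.
rewrite -(ler_pM2l nz') -Normc.normcM.
have z0r : normc (z - z) < r by rewrite subrr Normc.normc0.
(* Adding the expansions at z and at x cancels the values of u and leaves (x - z) (d x - d z). *)
have := lerD (Hd x z xr z0r) (Hd z x z0r xr).
rewrite [normc (z - x)]normc_distC.
have -> : normc (x - z) * (2 * C * normc (x - z)) =
  C * normc (x - z) ^+ 2 + C * normc (x - z) ^+ 2 by ring.
apply: le_trans; apply: le_trans (normc_triangle _ _).
rewrite (_ : u x - u z - (x - z) * d z + (u z - u x - (z - x) * d x) =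
  (x - z) * (d x - d z)) //; ring.
Qed.

End AnalyticC1.

(** * Means over the circle *)

Section CircleMean.
Variable R : realType.
Implicit Types (f g h : R -> R[i]) (c : R[i]) (t : R).

Local Notation normc := (@Normc.normc R).
Local Notation Re := (@complex.Re R).
Local Notation Im := (@complex.Im R).
Local Notation mu := (@lebesgue_measure R).
Local Notation angles := (@angles R).

Definition cmeasurable f := measurable_fun angles (fun t => Re (f t)) /\
  measurable_fun angles (fun t => Im (f t)).

Definition cintegrable f := mu.-integrable angles (fun t => (Re (f t))%:E) /\
  mu.-integrable angles (fun t => (Im (f t))%:E).

Lemma measurable_angles : measurable angles.
Proof. exact: measurable_itv. Qed.
Local Hint Resolve measurable_angles : core.

Lemma twopi_gt0 : 0 < 2 * pi :> R.
Proof. by rewrite mulr_gt0// pi_gt0. Qed.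
Local Hint Resolve twopi_gt0 : core.

Lemma aeS (P Q : R -> Prop) : (forall t, P t -> Q t) ->
  {ae mu, forall t, P t} -> {ae mu, forall t, Q t}.
Proof. by move=> PQ [A [mA A0 PA]]; exists A; split=> // t /= Qt; apply: PA => /= /PQ. Qed.



Lemma mu_angles : mu angles = (2 * pi)%:E.
Proof. by rewrite /angles lebesgue_measure_itv /= lte_fin twopi_gt0 sube0. Qed.

Lemma cintegrable_measurable f : cintegrable f -> cmeasurable f.
Proof.
by move=> [/measurable_int/measurable_EFinP ? /measurable_int/measurable_EFinP ?].
Qed.

Lemma cmeasurableD f g : cmeasurable f -> cmeasurable g ->
  cmeasurable (fun t => f t + g t).
Proof.
move=> [? ?][? ?]; split.
  by under eq_fun do rewrite ReD; exact: measurable_funD.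
by under eq_fun do rewrite ImD; exact: measurable_funD.
Qed.

Lemma cmeasurableM f g : cmeasurable f -> cmeasurable g ->
  cmeasurable (fun t => f t * g t).
Proof.
move=> [? ?][? ?]; split.
  by under eq_fun do rewrite ReM; apply: measurable_funB; exact: measurable_funM.
by under eq_fun do rewrite ImM; apply: measurable_funD; exact: measurable_funM.
Qed.

Lemma cmeasurableJ f : cmeasurable f -> cmeasurable (fun t => (f t)^*).
Proof.
move=> [? ?]; split; first by under eq_fun do rewrite ReJ.
by under eq_fun do rewrite ImJ; apply: measurableT_comp.
Qed.

Lemma cmeasurable_cst c : cmeasurable (fun=> c).
Proof. by split; exact: measurable_cst. Qed.

Lemma cmeasurable_normc f : cmeasurable f -> measurable_fun angles (fun t => normc (f t)).
Proof.
move=> [mr mi].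
have -> : (fun t => normc (f t)) = (fun t => Num.sqrt (Re (f t) ^+ 2 + Im (f t) ^+ 2)).
  by apply/funext => t; rewrite -normc_sqr sqrtr_sqr ger0_norm ?normc_ge0.
apply: (@measurableT_comp _ _ _ _ _ _ (@Num.sqrt R)) => //.
  by apply: continuous_measurable_fun; exact: sqrt_continuous.
by apply: measurable_funD; exact: measurable_funX.
Qed.

Lemma cintegrable_dominated f (B : R -> R) : cmeasurable f ->
  mu.-integrable angles (EFin \o B) ->
  (forall t, angles t -> normc (f t) <= B t) -> cintegrable f.
Proof.
move=> [mr mi] iB fB; split.
  apply: le_integrable iB => //; first exact/measurable_EFinP.
  move=> t tA; rewrite lee_fin; apply: le_trans (ler_norm _).
  exact: le_trans (Re_le_normc _) (fB t tA).
apply: le_integrable iB => //; first exact/measurable_EFinP.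
move=> t tA; rewrite lee_fin; apply: le_trans (ler_norm _).
exact: le_trans (Im_le_normc _) (fB t tA).
Qed.

Lemma integrable_cst_angles (k : R) : mu.-integrable angles (EFin \o cst k).
Proof. apply: measurable_bounded_integrable => //; first by rewrite /= mu_angles ltry.
exact: bounded_cst. Qed.

Lemma cintegrable_bounded f (B : R) : cmeasurable f ->
  (forall t, angles t -> normc (f t) <= B) -> cintegrable f.
Proof. by move=> mf fB; apply: (cintegrable_dominated mf (integrable_cst_angles B)). Qed.

Lemma cintegrable_cst c : cintegrable (fun=> c).
Proof. exact: cintegrable_bounded (cmeasurable_cst c) (fun t _ => lexx _). Qed.

Lemma cintegrableD f g : cintegrable f -> cintegrable g ->
  cintegrable (fun t => f t + g t).
Proof.
move=> [? ?][? ?]; split.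
  by under eq_fun do rewrite ReD EFinD; exact: integrableD.
by under eq_fun do rewrite ImD EFinD; exact: integrableD.
Qed.

Lemma cintegrableZ c f : cintegrable f -> cintegrable (fun t => c * f t).
Proof.
move=> [? ?]; split.
  under eq_fun do rewrite ReM EFinB.
  by apply: integrableB => //; under eq_fun do rewrite EFinM; exact: integrableZl.
under eq_fun do rewrite ImM EFinD.
by apply: integrableD => //; under eq_fun do rewrite EFinM; exact: integrableZl.
Qed.

Lemma circle_mean_eq f g : (forall t, angles t -> f t = g t) ->
  circle_mean f = circle_mean g.
Proof.
move=> fg; rewrite /circle_mean; congr ((_ * _) +i* (_ * _));
  by apply: eq_Rintegral => t; rewrite inE => /fg ->.
Qed.

Lemma circle_meanD f g : cintegrable f -> cintegrable g ->
  circle_mean (fun t => f t + g t) = circle_mean f + circle_mean g.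
Proof.
move=> [? ?][? ?]; apply: complexP; rewrite ?ReD ?ImD /circle_mean /=.
  by under eq_Rintegral do rewrite ReD; rewrite RintegralD// mulrDr.
by under eq_Rintegral do rewrite ImD; rewrite RintegralD// mulrDr.
Qed.

Lemma circle_meanZ c f : cintegrable f ->
  circle_mean (fun t => c * f t) = c * circle_mean f.
Proof.
move=> [fr fi].
have Z (k : R) (F : R -> R) : mu.-integrable angles (EFin \o F) ->
    mu.-integrable angles (fun t => (k * F t)%:E).
  by move=> h; under eq_fun do rewrite EFinM; exact: integrableZl.
apply: complexP; rewrite ?ReM ?ImM /circle_mean /=.
  under eq_Rintegral do rewrite ReM.
  rewrite RintegralB//; [|exact: Z|exact: Z].
  by rewrite !RintegralZl//; ring.
under eq_Rintegral do rewrite ImM.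
rewrite RintegralD//; [|exact: Z|exact: Z].
by rewrite !RintegralZl//; ring.
Qed.

Lemma circle_meanJ f : cintegrable f ->
  circle_mean (fun t => (f t)^*) = (circle_mean f)^*.
Proof.
move=> [fr fi]; apply: complexP; rewrite ?ReJ ?ImJ /circle_mean /=.
  by under eq_Rintegral do rewrite ReJ.
by under eq_Rintegral do rewrite ImJ -mulN1r; rewrite RintegralZl//; ring.
Qed.

Lemma circle_mean_cst c : circle_mean (fun=> c) = c.
Proof.
apply: complexP; rewrite /circle_mean /= Rintegral_cst//= mu_angles /=.
all: by rewrite mulrC mulfK// gt_eqF.
Qed.

Lemma circle_mean_ae f g : cmeasurable f -> cmeasurable g -> ae_eq_circle f g ->
  circle_mean f = circle_mean g.
Proof.
move=> [fr fi][gr gi] fg; rewrite /circle_mean /Rintegral.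
congr ((_ * fine _) +i* (_ * fine _)).
  apply: ae_eq_integral => //; [exact/measurable_EFinP|exact/measurable_EFinP|].
  by apply: aeS fg => t fg tA; rewrite fg.
apply: ae_eq_integral => //; [exact/measurable_EFinP|exact/measurable_EFinP|].
by apply: aeS fg => t fg tA; rewrite fg.
Qed.

(** The factor 2 comes from bounding real and imaginary parts separately. It is harmless, as the
    bound only serves to show that errors tend to 0. *)
Lemma normc_circle_mean_le f (B : R -> R) : cmeasurable f ->
  mu.-integrable angles (EFin \o B) ->
  (forall t, angles t -> normc (f t) <= B t) ->
  normc (circle_mean f) <= 2 * ((2 * pi)^-1 * \int[mu]_(t in angles) B t).
Proof.
move=> mf iB fB; have [fr fi] := cintegrable_dominated mf iB fB.
have key (F : R -> R) : mu.-integrable angles (EFin \o F) ->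
    (forall t, angles t -> `|F t| <= B t) ->
    `|(2 * pi)^-1 * \int[mu]_(t in angles) F t| <=
      (2 * pi)^-1 * \int[mu]_(t in angles) B t.
  have c0 : 0 <= (2 * pi)^-1 :> R by rewrite invr_ge0 ltW.
  move=> iF FB; rewrite normrM (ger0_norm c0); apply: ler_wpM2l => //.
  apply: le_trans (le_normr_Rintegral _ _) _ => //.
  by apply: le_Rintegral => //; exact: integrable_norm.
apply: le_trans (normc_le_ReIm _) _; rewrite mulr_natl mulr2n lerD//=.
  by apply: key => // t /fB; apply: le_trans; exact: Re_le_normc.
by apply: key => // t /fB; apply: le_trans; exact: Im_le_normc.
Qed.

Lemma normc_circle_mean_bound f (B : R) : cmeasurable f ->
  (forall t, angles t -> normc (f t) <= B) -> normc (circle_mean f) <= 2 * B.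
Proof.
move=> mf fB; have := normc_circle_mean_le mf (integrable_cst_angles B) fB.
rewrite Rintegral_cst//= mu_angles /= => h; apply: le_trans h _.
by rewrite [B * _]mulrC mulKf// gt_eqF.
Qed.

Lemma continuous_cmeasurable f :
  continuous (f : R -> R[i]^o) -> cmeasurable f.
Proof.
move=> cf; split; apply: measurable_funS measurableT _ _ => //;
  apply: continuous_measurable_fun => t;
  by have /cvgcP[] := cf t.
Qed.

End CircleMean.

(** * The exponential map of the circle *)

Section Expi.
Variable R : realType.
Implicit Types t : R.

Local Notation normc := (@Normc.normc R).
Local Notation Re := (@complex.Re R).
Local Notation Im := (@complex.Im R).
Local Notation mu := (@lebesgue_measure R).
Local Notation angles := (@angles R).

Lemma normc_expi t : normc (expi t) = 1.
Proof. by rewrite /= cos2Dsin2 sqrtr1. Qed.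

Lemma expiJ t : expi t * (expi t)^* = 1.
Proof.
apply: complexP; rewrite /= ?mulrN ?opprK; last by rewrite mulrC addNr.
by rewrite -!expr2 cos2Dsin2.
Qed.

Lemma expiD s t : expi (s + t) = expi s * expi t.
Proof. by apply: complexP; rewrite /= ?cosD ?sinD// addrC [cos s * _]mulrC. Qed.

Lemma expi0 : expi 0 = 1 :> R[i].
Proof. by rewrite /expi cos0 sin0. Qed.

Lemma expi2pi : expi (2 * pi) = 1 :> R[i].
Proof. by rewrite /expi mulr_natl cos2pi sin2pi. Qed.

Lemma expi_natM n t : expi (n%:R * t) = expi t ^+ n.
Proof.
elim: n => [|n IH]; first by rewrite mul0r expi0 expr0.
by rewrite mulrS mulrDl mul1r expiD IH exprS.
Qed.

Lemma continuous_expi : continuous (@expi R : R -> R[i]^o).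
Proof.
move=> t; apply/cvgcP; split; [exact: continuous_cos|exact: continuous_sin].
Qed.

(** The fundamental theorem of calculus over a full period. It makes the means of the powers of
    e^{it} vanish, and later the derivative in s in Cauchy's formula. *)
Lemma Rintegral_periodic_derive (F f : R -> R) :
  (forall t, is_derive t 1 F (f t)) -> continuous f -> F 0 = F (2 * pi) ->
  \int[mu]_(t in angles) f t = 0.
Proof.
move=> dF cf F02.
have cF : continuous F.
  by move=> t; apply: differentiable_continuous; apply/derivable1_diffP; exact: ex_derive.
rewrite /Rintegral (@continuous_FTC2 _ f F 0 (2 * pi)) ?F02 ?subee//.
- exact: twopi_gt0.
- exact: continuous_subspaceT.
- split; first by move=> t _; exact: ex_derive.
  + exact: cvg_at_right_filter (cF _).
  + exact: cvg_at_left_filter (cF _).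
- by move=> t _; rewrite derive1E; exact: derive_val.
Qed.

Lemma circle_mean_expiX n : circle_mean (fun t => expi t ^+ n.+1) = 0.
Proof.
have n0 : n.+1%:R != 0 :> R by [].
have cexp : continuous (fun t => n.+1%:R * t : R).
  by move=> t; apply: cvgM; [exact: cvg_cst|exact: cvg_id].
have H1 : \int[mu]_(t in angles) cos (n.+1%:R * t) = 0.
  apply: (@Rintegral_periodic_derive (fun t => n.+1%:R^-1 * sin (n.+1%:R * t))).
  - move=> t; apply: is_derive_eq; rewrite /GRing.scale /= mulr1.
    by rewrite mulrC mulfK.
  - by move=> t; apply: continuous_comp; [exact: cexp|exact: continuous_cos].
  - by have := congr1 Im (expi_natM n.+1 (2 * pi)); rewrite expi2pi expr1n /= mulr0 sin0 => ->.
have H2 : \int[mu]_(t in angles) sin (n.+1%:R * t) = 0.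
  apply: (@Rintegral_periodic_derive (fun t => - (n.+1%:R^-1 * cos (n.+1%:R * t)))).
  - move=> t; apply: is_derive_eq; rewrite /GRing.scale /= mulr1.
    by rewrite mulrC mulfK// opprK.
  - by move=> t; apply: continuous_comp; [exact: cexp|exact: continuous_sin].
  - by have := congr1 Re (expi_natM n.+1 (2 * pi)); rewrite expi2pi expr1n /= mulr0 cos0 => ->.
rewrite /circle_mean; under eq_Rintegral do rewrite -expi_natM.
rewrite H1 mulr0; under eq_Rintegral do rewrite -expi_natM.
by rewrite H2 mulr0.
Qed.

End Expi.

(** * Chain rule along a curve in the disc *)

Section Cauchy.
Variable R : realType.
Implicit Types (w z : R[i]) (u du : R[i] -> R[i]) (s t : R).

Local Notation normc := (@Normc.normc R).
Local Notation Re := (@complex.Re R).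
Local Notation Im := (@complex.Im R).
Local Notation mu := (@lebesgue_measure R).
Local Notation angles := (@angles R).

(** The Caratheodory factors of u and of the two components of g multiply. The constant c lets one
    real statement serve both components, since Re(- i x) = Im x. *)
Lemma is_derive_ReC1 u du (g : R -> R[i]) c t (a b : R) : complex_C1 u du ->
  disc (g t) -> is_derive t 1 (fun t => Re (g t)) a ->
  is_derive t 1 (fun t => Im (g t)) b ->
  is_derive t 1 (fun t => Re (c * u (g t))) (Re (c * (du (g t) * (a +i* b)))).
Proof.
move=> Hu gt da db.
have [_ [phi [phiE cphi phiz]]] := Hu _ gt.
have cg : {for t, continuous (g : R -> R[i]^o)}.
  by apply/(cvgcP (nbhs_filter t)); split;
    apply: differentiable_continuous; apply/derivable1_diffP; exact: ex_derive.
have /is_derive1_caratheodory [g1 [g1E cg1 g1t]] := da.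
have /is_derive1_caratheodory [g2 [g2E cg2 g2t]] := db.
apply/is_derive1_caratheodory.
exists (fun s => Re (c * (phi (g s) * (g1 s +i* g2 s)))); split.
- move=> s; rewrite -ReB -mulrBr phiE.
  have -> : g s - g t = (g1 s +i* g2 s) * (s - t)%:C.
    by apply: complexP; rewrite ?ReB ?ImB ?g1E ?g2E ?ReM ?ImM /=; ring.
  by rewrite !mulrA [in LHS]ReM /=; ring.
- have : (c * (phi (g s) * (g1 s +i* g2 s)) : R[i]^o) @[s --> t] -->
      (c * (phi (g t) * (g1 t +i* g2 t)) : R[i]^o).
    apply: cvgM; first exact: cvg_cst.
    apply: cvgM; first exact: (continuous_comp cg cphi).
    by apply/(cvgcP (nbhs_filter t)).
  by move/(cvgcP (nbhs_filter t)) => [].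
- by rewrite phiz g1t g2t.
Qed.

End Cauchy.

(** * Cauchy's formula *)

Section CauchyFormula.
Variable R : realType.
Implicit Types (w z : R[i]) (u du : R[i] -> R[i]) (s t : R).

Local Notation normc := (@Normc.normc R).
Local Notation Re := (@complex.Re R).
Local Notation Im := (@complex.Im R).
Local Notation mu := (@lebesgue_measure R).
Local Notation angles := (@angles R).

Lemma complex_C1_continuous u du z : complex_C1 u du -> disc z ->
  {for z, continuous (u : R[i]^o -> R[i]^o)}.
Proof.
move=> Hu zd; have [_ [phi [phiE cphi phiz]]] := Hu _ zd.
have -> : u = (fun x => u z + phi x * (x - z)).
  by apply/funext => x; rewrite -phiE addrC subrK.
have FF : Filter (nbhs (z : R[i]^o)) := nbhs_filter _.
have h : (u z + phi x * (x - z) : R[i]^o) @[x --> (z : R[i]^o)] -->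
    (u z + phi z * (z - z) : R[i]^o).
  apply: cvgD; first exact: cvg_cst.
  apply: cvgM; first exact: cphi.
  by apply: cvgB; [exact: cvg_id|exact: cvg_cst].
exact: h.
Qed.

Lemma continuous_integrable_angles (f : R -> R) : continuous f ->
  mu.-integrable angles (EFin \o f).
Proof.
move=> cf; apply: continuous_compact_integrable; first exact: segment_compact.
exact: continuous_subspaceT.
Qed.

Lemma continuous_conj (f : R -> R[i]) : continuous (f : R -> R[i]^o) ->
  continuous (fun t => (f t)^* : R[i]^o).
Proof.
move=> cf t; have /(cvgcP (nbhs_filter t)) [h1 h2] := cf t.
apply/(cvgcP (nbhs_filter t)); split.
  by under eq_cvg do rewrite ReJ; rewrite ReJ.
by under eq_cvg do rewrite ImJ; rewrite ImJ; exact: cvgN.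
Qed.

Lemma cauchy_kernel_neq0 (xi : R[i]) t : normc xi < 1 ->
  1 - xi * (expi t)^* != 0.
Proof.
move=> xi1; rewrite subr_eq0; apply/eqP => /(congr1 normc).
rewrite Normc.normc1 Normc.normcM => h.
have /eqP := congr1 normc (expiJ t).
rewrite Normc.normcM normc_expi mul1r Normc.normc1 => /eqP h'.
by move: xi1; rewrite h h' mulr1 ltxx.
Qed.

Lemma continuous_cauchy_kernel (xi : R[i]) : normc xi < 1 ->
  continuous (fun t => (1 - xi * (expi t)^*)^-1 : R[i]^o).
Proof.
move=> xi1 t.
have h : (1 - xi * (expi t')^* : R[i]^o) @[t' --> t] --> (1 - xi * (expi t)^* : R[i]^o).
  apply: cvgB; first exact: cvg_cst.
  apply: cvgM; first exact: cvg_cst.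
  exact: (continuous_conj (@continuous_expi R)).
exact: (@cvgV (R[i] : numFieldType) _ _ _ _ _ (cauchy_kernel_neq0 t xi1) h).
Qed.

(** The integral is followed from s = 0, where gam is the constant w, to s = 1, where it runs over
    the circle of radius rho. The mean of the kernel stays as a factor; [circle_mean_cauchy_kernel]
    shows that it is 1. *)
Lemma cauchy_formula u du (rho : R) w : complex_C1 u du ->
  0 < rho < 1 -> normc w < rho ->
  circle_mean (fun t => u (rho%:C * expi t) * (1 - w / rho%:C * (expi t)^*)^-1) =
  u w * circle_mean (fun t => (1 - w / rho%:C * (expi t)^*)^-1).
Proof.
move=> Hu /andP[rho0 rho1] wrho.
set xi := w / rho%:C; set K := fun t => (1 - xi * (expi t)^*)^-1.
have xi1 : normc xi < 1.
  by rewrite Normc.normcM Normc.normcV normc_real gtr0_norm// ltr_pdivrMr// mul1r.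
have rhoC0 : rho%:C != 0 :> R[i] by rewrite eq_complex /= gt_eqF.
pose gam s t := w + s%:C * (rho%:C * expi t - w).
(* As conj(e^{it}) = e^{-it}, K is rho e^{it} / (rho e^{it} - w), and its denominator cancels the
   factor rho e^{it} - w produced by d/ds. *)
have KE t : (rho%:C * expi t - w) * K t = rho%:C * expi t.
  have -> : rho%:C * expi t - w = rho%:C * expi t * (1 - xi * (expi t)^*).
    by rewrite mulrBr mulr1 mulrACA expiJ mulr1 /xi [_ * (w / _)]mulrC divfK.
  by rewrite mulfK// cauchy_kernel_neq0.
(* gam s t stays in the disc for s slightly outside [0, 1], which makes room for
   differentiating at the end points. *)
pose dl : R := (1 - rho) / 4.
have dl0 : 0 < dl by rewrite /dl; lra.
have gam_disc s t : - dl <= s <= 1 + dl -> disc (gam s t).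
  move=> sI; rewrite /disc /= normc_lt.
  have -> : gam s t = s%:C * (rho%:C * expi t) + (1 - s)%:C * w.
    by rewrite /gam rmorphB rmorph1; ring.
  apply: le_lt_trans (normc_triangle _ _) _.
  rewrite !Normc.normcM !normc_real normc_expi mulr1 (gtr0_norm rho0).
  apply: (@le_lt_trans _ _ ((`|s| + `|1 - s|) * rho)).
    by rewrite mulrDl lerD2l ler_wpM2l// ltW.
  have : `|s| + `|1 - s| <= 1 + 2 * dl.
    move: sI => /andP[? ?].
    by case: (ger0P s); case: (ger0P (1 - s)) => *; lra.
  move=> /(ler_wpM2r (ltW rho0)) /le_lt_trans; apply.
  (* The inequality (1 + (1 - rho) / 2) rho < 1 amounts to (1 - rho) (2 - rho) > 0. *)
  by rewrite /dl; nra.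
have cexpt t : (rho%:C * expi t - w : R[i]^o) @[t --> t] --> (rho%:C * expi t - w : R[i]^o).
  apply: cvgB; last exact: cvg_cst.
  by apply: cvgM; [exact: cvg_cst|exact: continuous_expi].
have cgam s t : (gam s t' : R[i]^o) @[t' --> t] --> (gam s t : R[i]^o).
  apply: cvgD; first exact: cvg_cst.
  by apply: cvgM; [exact: cvg_cst|exact: cexpt].
pose f c s t := Re (c * (u (gam s t) * K t)).
pose D c s t := Re (c * (du (gam s t) * (rho%:C * expi t))).
have cf c s : - dl <= s <= 1 + dl -> continuous (f c s).
  move=> sI t.
  have : (c * (u (gam s t') * K t') : R[i]^o) @[t' --> t] -->
      (c * (u (gam s t) * K t) : R[i]^o).
    apply: cvgM; first exact: cvg_cst.
    apply: cvgM; last exact: continuous_cauchy_kernel.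
    apply: continuous_comp (cgam s t) _.
    by apply: complex_C1_continuous Hu _; exact: gam_disc.
  by move/(cvgcP (nbhs_filter t)) => [].
have cD c s : - dl <= s <= 1 + dl -> continuous (D c s).
  move=> sI t.
  have : (c * (du (gam s t') * (rho%:C * expi t')) : R[i]^o) @[t' --> t] -->
      (c * (du (gam s t) * (rho%:C * expi t)) : R[i]^o).
    apply: cvgM; first exact: cvg_cst.
    apply: cvgM; last by apply: cvgM; [exact: cvg_cst|exact: continuous_expi].
    apply: continuous_comp (cgam s t) _.
    by have [] := Hu _ (gam_disc s t sI).
  by move/(cvgcP (nbhs_filter t)) => [].
have df c s t : - dl <= s <= 1 + dl -> is_derive s 1 (f c ^~ t) (D c s t).
  move=> sI.
  have -> : f c ^~ t = fun s => Re ((c * K t) * u (gam s t)).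
    by apply/funext => s'; rewrite /f; congr Re; ring.
  have -> : D c s t = Re ((c * K t) *
     (du (gam s t) * (Re (rho%:C * expi t - w) +i* Im (rho%:C * expi t - w)))).
    have -> : Re (rho%:C * expi t - w) +i* Im (rho%:C * expi t - w) =
      rho%:C * expi t - w by apply: complexP.
    by rewrite /D -[in LHS](KE t); congr Re; ring.
  have aff (A B : R) : is_derive s 1 (fun s => A + s * B) B.
    apply: is_derive_eq; rewrite /GRing.scale /=; ring.
  apply: (is_derive_ReC1 (g := gam ^~ t) _ Hu (gam_disc s t sI)).
    have -> : (fun s => Re (gam s t)) = (fun s => Re w + s * Re (rho%:C * expi t - w)).
      by apply/funext => s'; rewrite /gam ReD [Re (_ * _)]ReM /= mul0r subr0.
    exact: aff.
  have -> : (fun s => Im (gam s t)) = (fun s => Im w + s * Im (rho%:C * expi t - w)).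
    by apply/funext => s'; rewrite /gam ImD [Im (_ * _)]ImM /= mul0r addr0.
  exact: aff.
(* s D is the derivative in t of the 2pi-periodic function Re (- i c u (gam s t)). *)
have D0 c s : 0 < s < 1 -> \int[mu]_(t in angles) D c s t = 0.
  move=> /andP[s0 s1].
  have sI : - dl <= s <= 1 + dl by lra.
  have sD : \int[mu]_(t in angles) (s * D c s t) = 0.
    have dF t : is_derive t 1 (fun t => Re (- 'i * c * u (gam s t))) (s * D c s t).
      have -> : s * D c s t = Re (- 'i * c *
         (du (gam s t) * ((- (s * (rho * sin t))) +i* (s * (rho * cos t))))).
        rewrite /D; case: c (du _) => c1 c2 [d1 d2] /=; ring.
      have dRe : is_derive t 1 (fun t => Re (gam s t)) (- (s * (rho * sin t))).
        have -> : (fun t => Re (gam s t)) = (fun t => Re w + s * (rho * cos t - Re w)).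
          apply/funext => t'; rewrite /gam ReD [Re (_ * _)]ReM ReB ReM /=; ring.
        apply: is_derive_eq; rewrite /GRing.scale /=; ring.
      have dIm : is_derive t 1 (fun t => Im (gam s t)) (s * (rho * cos t)).
        have -> : (fun t => Im (gam s t)) = (fun t => Im w + s * (rho * sin t - Im w)).
          apply/funext => t'; rewrite /gam ImD [Im (_ * _)]ImM ImB ImM /=; ring.
        apply: is_derive_eq; rewrite /GRing.scale /=; ring.
      exact: (@is_derive_ReC1 _ u du (gam s) (- 'i * c) t _ _ Hu (gam_disc s t sI) dRe dIm).
    apply: (Rintegral_periodic_derive dF).
    - by move=> t; apply: cvgM; [exact: cvg_cst|exact: cD].
    - by rewrite /gam expi0 expi2pi.
  have := sD; rewrite RintegralZl//.
  + by move/eqP; rewrite mulf_eq0 gt_eqF//= => /eqP.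
  + exact: measurable_angles.
  + by apply: continuous_integrable_angles; exact: cD.
(* Compactness of the rectangle of parameters provides the dominating constant for differentiation
   under the integral. *)
have [B duB] : exists B, forall s t, - dl <= s <= 1 + dl -> angles t ->
    normc (du (gam s t)) <= B.
  pose A : set (R * R) := `[- dl, 1 + dl]%classic `*` angles.
  have cA : compact A by apply: compact_setX; exact: segment_compact.
  have cdu : {within A, continuous (fun x : R * R => normc (du (gam x.1 x.2)) : R^o)}.
    apply: continuous_in_subspaceT => -[s t]; rewrite inE => -[/= sI tA].
    rewrite /= in_itv /= in sI.
    have [cdu _] := Hu _ (gam_disc s t sI).
    have FF : Filter (nbhs ((s, t) : R * R)) := nbhs_filter _.
    have cg : (gam x.1 x.2 : R[i]^o) @[x --> ((s, t) : R * R)] --> (gam s t : R[i]^o).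
      apply: cvgD; first exact: cvg_cst.
      apply: cvgM.
        by apply/(cvgcP FF); split => /=; [exact: cvg_fst|exact: cvg_cst].
      apply: cvgB; last exact: cvg_cst.
      apply: cvgM; first exact: cvg_cst.
      apply: (@cvg_comp _ _ _ (fun x : R * R => x.2) (@expi R : R -> R[i]^o) _ (nbhs t)).
        exact: cvg_snd.
      exact: continuous_expi.
    have h : (du (gam x.1 x.2) : R[i]^o) @[x --> ((s, t) : R * R)] -->
      (du (gam s t) : R[i]^o) := cvg_comp _ _ cg cdu.
    exact: (cvg_normc FF h).
  have /compact_bounded [M [_ HM]] := continuous_compact cdu cA.
  exists (M + 1) => s t sI tA.
  apply: le_trans (ler_norm _) _.
  by apply: (HM (M + 1)); [rewrite ltrDl|exists (s, t)].
pose I c s := \int[mu]_(t in angles) f c s t.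
have intf c s : - dl <= s <= 1 + dl -> mu.-integrable angles (EFin \o f c s).
  by move=> sI; apply: continuous_integrable_angles; exact: cf.
have dI c s : - dl < s < 1 + dl -> derivable (I c) s 1 /\
    derive1 (I c) s = \int[mu]_(t in angles) D c s t.
  move=> sI.
  have sI' : `]- dl, 1 + dl[%classic s by rewrite /= in_itv.
  have W x : `]- dl, 1 + dl[%classic x -> - dl <= x <= 1 + dl.
    by rewrite /= in_itv /= => /andP[*]; lra.
  have h1 x : `]- dl, 1 + dl[%classic x -> mu.-integrable angles (EFin \o f c x).
    by move=> /W; exact: intf.
  have h2 x t : `]- dl, 1 + dl[%classic x -> angles t -> derivable (f c ^~ t) x 1.
    by move=> /W xI _; have dd := df c x t xI; exact: ex_derive.
  have pE x t : `]- dl, 1 + dl[%classic x -> partial1of2 (f c) x t = D c x t.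
    by move=> /W xI; rewrite partial1of2E; have dd := df c x t xI; exact: derive_val.
  have h3 x t : `]- dl, 1 + dl[%classic x -> angles t ->
      `|partial1of2 (f c) x t| <= `|normc c * (B * rho)|.
    move=> xI tA; rewrite pE//; apply: le_trans (Re_le_normc _) _.
    apply: le_trans (ler_norm _).
    rewrite !Normc.normcM normc_expi mulr1 normc_real gtr0_norm//.
    apply: ler_wpM2l; first exact: normc_ge0.
    by apply: ler_wpM2r; [exact: ltW|apply: duB => //; exact: W].
  have h4 := integrable_cst_angles `|normc c * (B * rho)|.
  have h5 (y : R) : 0 <= cst `|normc c * (B * rho)| y by exact: normr_ge0.
  split.
    exact: (@derivable_under_integral _ _ _ mu (f c) _ (@measurable_angles R)
      _ _ _ sI' h1 h2 _ h5 h4 h3).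
  rewrite (@differentiation_under_integral _ _ _ mu (f c) _ (@measurable_angles R)
      _ _ _ sI' h1 h2 _ h5 h4 h3).
  by apply: eq_Rintegral => t _; rewrite pE.
(* The mean value theorem asks for the derivative on the open interval only, where s > 0 and [D0]
   applies; continuity suffices at the end points. *)
have I01 c : I c 1 = I c 0.
  have cI : {within `[0, 1], continuous (I c)}.
    apply: continuous_in_subspaceT => s; rewrite inE /= in_itv /= => /andP[s0 s1].
    apply: differentiable_continuous; apply/derivable1_diffP.
    by apply: (proj1 (dI c s _)); lra.
  have dI0 s : s \in `]0, 1[ -> is_derive s 1 (I c) (cst 0 s).
    rewrite in_itv /= => s01; have /andP[s0 s1] := s01.
    have [|d1 d2] := dI c s; first lra.
    by apply: DeriveDef => //; rewrite -derive1E d2 D0.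
  have [|x _] := MVT _ dI0 cI; first exact: ltr01.
  by rewrite /= mul0r => /eqP; rewrite subr_eq0 => /eqP.
have mK : cintegrable K.
  have cK := continuous_cauchy_kernel xi1.
  by split; apply: continuous_integrable_angles => t; have /cvgcP[] := cK t.
rewrite -circle_meanZ//.
have g1 t : gam 1 t = rho%:C * expi t by rewrite /gam mul1r addrC subrK.
have g0 t : gam 0 t = w by rewrite /gam mul0r addr0.
have E1 c : \int[mu]_(t in angles) Re (c * (u (rho%:C * expi t) * K t)) =
    \int[mu]_(t in angles) Re (c * (u w * K t)).
  have -> : \int[mu]_(t in angles) Re (c * (u (rho%:C * expi t) * K t)) = I c 1.
    by apply: eq_Rintegral => t _; rewrite /f g1.
  by rewrite I01; apply: eq_Rintegral => t _; rewrite /f g0.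
(* Taking c = 1 compares the real parts, c = - i the imaginary parts. *)
have NiRe z : Re (- 'i * z) = Im z by rewrite ReM /=; ring.
rewrite /circle_mean; congr ((_ * _) +i* (_ * _)).
  etransitivity; [|etransitivity; [exact: (E1 1)|]];
    by apply: eq_Rintegral => t _; rewrite mul1r.
etransitivity; [|etransitivity; [exact: (E1 (- 'i))|]];
  by apply: eq_Rintegral => t _; rewrite NiRe.
Qed.

End CauchyFormula.

(** * Means against functions of the Hardy space *)

Section HardyMean.
Variable R : realType.
Implicit Types (w z : R[i]) (u du : R[i] -> R[i]) (t : R) (f g h : R -> R[i]).

Local Notation normc := (@Normc.normc R).
Local Notation Re := (@complex.Re R).
Local Notation Im := (@complex.Im R).
Local Notation mu := (@lebesgue_measure R).
Local Notation angles := (@angles R).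

Lemma cintegrable_sum (F : nat -> R -> R[i]) N : (forall n, cintegrable (F n)) ->
  cintegrable (fun t => \sum_(0 <= n < N) F n t).
Proof.
move=> iF; elim: N => [|N IH].
  by under eq_fun do rewrite big_nil; exact: cintegrable_cst.
by under eq_fun do rewrite big_nat_recr//=; exact: cintegrableD.
Qed.

Lemma circle_mean_sum (F : nat -> R -> R[i]) N : (forall n, cintegrable (F n)) ->
  circle_mean (fun t => \sum_(0 <= n < N) F n t) =
  \sum_(0 <= n < N) circle_mean (F n).
Proof.
move=> iF; elim: N => [|N IH].
  under circle_mean_eq do rewrite big_nil.
  by rewrite big_nil circle_mean_cst.
under circle_mean_eq do rewrite big_nat_recr//=.
by rewrite circle_meanD ?IH ?big_nat_recr//; exact: cintegrable_sum.
Qed.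

(** The exponent N + 1 lets callers split off the term of index 0 from a nonempty sum. *)
Lemma normc_eq0_geometric z (C r : R) : 0 <= r < 1 ->
  (forall N, normc z <= C * r ^+ N.+1) -> z = 0.
Proof.
move=> /andP[r0 r1] H; apply: Normc.eq0_normc; apply/eqP.
rewrite eq_le normc_ge0 andbT.
have := @cvg_geometric R C r; rewrite ger0_norm// => /(_ r1) /cvgr_to_ge; apply.
by near do rewrite /geometric/=; exists 1%N => // -[].
Unshelve. all: by end_near. Qed.

Lemma cmeasurable_expi : cmeasurable (@expi R).
Proof. exact: continuous_cmeasurable (@continuous_expi R). Qed.

Lemma cmeasurableX f n : cmeasurable f -> cmeasurable (fun t => f t ^+ n).
Proof.
move=> mf; elim: n => [|n IH].
  by under eq_fun do rewrite expr0; exact: cmeasurable_cst.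
by under eq_fun do rewrite exprS; exact: cmeasurableM.
Qed.

Lemma normc_expiJ t : normc (expi t)^* = 1.
Proof. by rewrite /= sqrrN cos2Dsin2 sqrtr1. Qed.

Lemma expi_neq0 t : expi t != 0.
Proof.
by apply/eqP => /(congr1 normc)/eqP; rewrite normc_expi Normc.normc0 oner_eq0.
Qed.

Lemma conjcX z n : (z ^+ n)^* = z^* ^+ n.
Proof. exact: rmorphXn. Qed.

Lemma innerE f g : inner f g = circle_mean (fun t => f t * conjc (g t)).
Proof. by []. Qed.

(** [Negz n] is -(n + 1), and conjugation inverts e^{it}; so negative Fourier coefficients are means
    against positive powers. *)
Lemma fourier_Negz f n :
  fourier f (Negz n) = circle_mean (fun t => f t * expi t ^+ n.+1).
Proof.
rewrite /fourier innerE; apply: circle_mean_eq => t _.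
cbv beta; congr (_ * _); change (expi t ^ Negz n) with (expi t ^+ n.+1)^-1.
rewrite conjc_inv conjcX; apply: (@mulfI _ ((expi t)^* ^+ n.+1)).
  by rewrite expf_neq0// conjc_eq0 expi_neq0.
rewrite -exprMn [X in _ = X ^+ _]mulrC expiJ expr1n mulfV// expf_neq0// conjc_eq0.
exact: expi_neq0.
Qed.

(** The geometric series of ratio q = xi e^{-it}, cut after N terms: what remains is g (1 - q)^-1
    q^N, with |q| = |xi|. *)
Lemma cauchy_kernel_expansion g (M : R) (xi : R[i]) N : cmeasurable g ->
  (forall t, angles t -> normc (g t) <= M) -> normc xi < 1 ->
  normc (circle_mean (fun t => g t * (1 - xi * (expi t)^*)^-1) -
    \sum_(0 <= n < N) xi ^+ n * circle_mean (fun t => g t * (expi t)^* ^+ n)) <=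
  2 * (M / (1 - normc xi)) * normc xi ^+ N.
Proof.
move=> mg gM xi1.
have mJ := cmeasurableJ cmeasurable_expi.
have mK : cmeasurable (fun t => (1 - xi * (expi t)^*)^-1).
  exact: continuous_cmeasurable (continuous_cauchy_kernel xi1).
(* Reverse triangle inequality: |1 - q| >= 1 - |xi|. *)
have Kb t : normc (1 - xi * (expi t)^*)^-1 <= (1 - normc xi)^-1.
  rewrite Normc.normcV lef_pV2 ?posrE ?subr_gt0//; last first.
    rewrite lt_neqAle normc_ge0 andbT eq_sym; apply/eqP => /Normc.eq0_normc.
    exact/eqP/cauchy_kernel_neq0.
  have := normc_triangle (1 - xi * (expi t)^*) (xi * (expi t)^*).
  by rewrite subrK Normc.normc1 Normc.normcM normc_expiJ mulr1 lerBlDr.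
have iK : cintegrable (fun t => g t * (1 - xi * (expi t)^*)^-1).
  apply: (@cintegrable_bounded _ _ (M * (1 - normc xi)^-1)); first exact: cmeasurableM.
  move=> t tA; rewrite Normc.normcM; apply: ler_pM; rewrite ?normc_ge0//.
  exact: gM.
have ig n : cintegrable (fun t => g t * (expi t)^* ^+ n).
  apply: (@cintegrable_bounded _ _ M); first by apply: cmeasurableM => //; exact: cmeasurableX.
  by move=> t tA; rewrite Normc.normcM normc_exp normc_expiJ expr1n mulr1 gM.
have -> : \sum_(0 <= n < N) xi ^+ n * circle_mean (fun t => g t * (expi t)^* ^+ n) =
    circle_mean (fun t => \sum_(0 <= n < N) xi ^+ n * (g t * (expi t)^* ^+ n)).
  rewrite circle_mean_sum => [|n]; last exact: cintegrableZ.
  by apply: eq_bigr => n _; rewrite circle_meanZ.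
rewrite -[X in _ - X]mul1r -mulNr -circle_meanZ; last first.
  by apply: cintegrable_sum => n; exact: cintegrableZ.
rewrite -circle_meanD//; last first.
  by apply: cintegrableZ; apply: cintegrable_sum => n; exact: cintegrableZ.
rewrite -mulrA; apply: normc_circle_mean_bound.
  apply: cmeasurableD; first exact: cmeasurableM.
  apply: cintegrable_measurable; apply: cintegrableZ.
  by apply: cintegrable_sum => n; exact: cintegrableZ.
move=> t tA; set q := xi * (expi t)^*.
have q1 : 1 - q != 0 by exact: cauchy_kernel_neq0.
have -> : g t * (1 - q)^-1 + -1 * (\sum_(0 <= n < N) xi ^+ n * (g t * (expi t)^* ^+ n)) =
    g t * (1 - q)^-1 * q ^+ N.
  have -> : \sum_(0 <= n < N) xi ^+ n * (g t * (expi t)^* ^+ n) =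
      g t * (1 - q)^-1 * (1 - q ^+ N).
    elim: N => [|N IH]; first by rewrite big_nil expr0 subrr mulr0.
    rewrite big_nat_recr//= IH mulrCA -exprMn -/q exprS.
    by field.
  by ring.
rewrite !Normc.normcM normc_exp /q Normc.normcM normc_expiJ mulr1.
apply: ler_wpM2r; first by rewrite exprn_ge0// normc_ge0.
by apply: ler_pM; rewrite ?normc_ge0// gM.
Qed.

(** In the expansion with g = 1, every term of index n > 0 has mean 0 and the remainder is
    geometric. *)
Lemma circle_mean_cauchy_kernel (xi : R[i]) : normc xi < 1 ->
  circle_mean (fun t => (1 - xi * (expi t)^*)^-1) = 1.
Proof.
move=> xi1; apply/eqP; rewrite -subr_eq0; apply/eqP.
apply: (@normc_eq0_geometric _ (2 * (1 / (1 - normc xi))) (normc xi)).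
  by rewrite normc_ge0.
move=> N.
have h1 t : angles t -> normc ((fun=> 1) t) <= 1 by rewrite Normc.normc1.
have := @cauchy_kernel_expansion (fun=> 1) 1 xi N.+1 (cmeasurable_cst 1) h1 xi1.
rewrite big_nat_recl//= big1_seq => [|n _].
  rewrite expr0 mul1r addr0; under circle_mean_eq do rewrite mul1r.
  under [X in _ - X]circle_mean_eq do rewrite mul1r expr0.
  by rewrite circle_mean_cst.
under circle_mean_eq do rewrite mul1r -rmorphXn.
rewrite circle_meanJ ?circle_mean_expiX ?rmorph0 ?mulr0//.
apply: (@cintegrable_bounded _ _ 1); first exact: cmeasurableX cmeasurable_expi.
by move=> t _; rewrite normc_exp normc_expi expr1n.
Qed.

Lemma integrable_scale (k : R) (F : R -> R) : mu.-integrable angles (EFin \o F) ->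
  mu.-integrable angles (EFin \o (fun t => k * F t)).
Proof.
move=> iF; have -> : EFin \o (fun t => k * F t) = (fun t => k%:E * (EFin \o F) t)%E.
  by apply/funext => t; rewrite /= EFinM.
by apply: integrableZl => //; exact: measurable_angles.
Qed.

Lemma L2_cmeasurable f : L2 f -> cmeasurable f.
Proof. by case. Qed.

(** The measure is finite and |f| <= 1 + |f|^2. *)
Lemma L2_integrable_normc f : L2 f -> mu.-integrable angles (EFin \o (fun t => normc (f t))).
Proof.
move=> Lf; have [_ _ i2] := Lf.
have i3 : mu.-integrable angles (fun t => (1 + (Re (f t) ^+ 2 + Im (f t) ^+ 2))%:E).
  under eq_fun do rewrite EFinD.
  by apply: integrableD => //; [exact: measurable_angles|exact: integrable_cst_angles].
apply: le_integrable i3 => //; first exact: measurable_angles.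
  by apply/measurable_EFinP; exact: cmeasurable_normc (L2_cmeasurable Lf).
move=> t _; rewrite lee_fin -normc_sqr ger0_norm ?normc_ge0//.
rewrite ger0_norm ?addr_ge0 ?sqr_ge0//.
have := sqr_ge0 (normc (f t) - 2^-1); nra.
Qed.

Lemma disc_circle (s : R) t : 0 <= s < 1 -> disc (s%:C * expi t).
Proof.
move=> /andP[s0 s1].
by rewrite /disc /= normc_lt Normc.normcM normc_expi mulr1 normc_real ger0_norm.
Qed.

Lemma continuous_circle u du (s : R) : complex_C1 u du -> 0 <= s < 1 ->
  continuous (fun t => u (s%:C * expi t) : R[i]^o).
Proof.
move=> Hu s01 t; have FF : Filter (nbhs t) := nbhs_filter _.
have c1 : (s%:C * expi t' : R[i]^o) @[t' --> t] --> (s%:C * expi t : R[i]^o).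
  by apply: cvgM; [exact: cvg_cst|exact: continuous_expi].
exact: (cvg_comp _ _ c1 (complex_C1_continuous Hu (disc_circle t s01))).
Qed.

Lemma L2_cintegrable h : L2 h -> cintegrable h.
Proof.
move=> Lh; exact: cintegrable_dominated (L2_cmeasurable Lh)
  (L2_integrable_normc Lh) (fun t _ => lexx _).
Qed.

(** Uniformly on the circle, u(r e^{it}) is a limit of polynomials in e^{it} with constant
    coefficient u(0); against h, the mean of every higher power vanishes. *)
Lemma circle_mean_radius_H2 u du (M r : R) h : complex_C1 u du ->
  (forall z, disc z -> normc (u z) <= M) -> 0 < r < 1 -> H2 h ->
  circle_mean (fun t => u (r%:C * expi t) * h t) = u 0 * circle_mean h.
Proof.
move=> Hu uM /andP[r0 r1] [Lh h0].
(* Cauchy's formula on a circle of radius rho > r leaves the ratio q = r / rho < 1 for the geometric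
   error. *)
pose rho := (1 + r) / 2; have rho01 : 0 < rho < 1 by rewrite /rho; apply/andP; lra.
have /andP[rho0 rho1] := rho01.
have rrho : r < rho by rewrite /rho; lra.
pose q := r / rho; have q01 : 0 <= q < 1.
  by rewrite /q divr_ge0 ?(ltW r0) ?(ltW rho0)//= ltr_pdivrMr// mul1r.
pose g t := u (rho%:C * expi t).
have mg : cmeasurable g by apply: continuous_cmeasurable; apply: (continuous_circle Hu); rewrite ltW.
have gM t : angles t -> normc (g t) <= M.
  by move=> _; apply: uM; apply: disc_circle; rewrite ltW.
pose a n := circle_mean (fun t => g t * (expi t)^* ^+ n).
(* Cauchy's formula at w = 0, where the kernel is the constant 1. *)
have a0 : a 0%N = u 0.
  have := @cauchy_formula _ u du rho 0 Hu rho01.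
  rewrite Normc.normc0 => /(_ rho0).
  under circle_mean_eq do rewrite mul0r mul0r subr0 invr1.
  under [in RHS]circle_mean_eq do rewrite mul0r mul0r subr0 invr1.
  rewrite circle_mean_cst mulr1 => <-.
  by apply: circle_mean_eq => t _; rewrite expr0.
pose E N := 2 * (M / (1 - q)) * q ^+ N.
have approx N t : normc (u (r%:C * expi t) -
     \sum_(0 <= n < N) (q%:C * expi t) ^+ n * a n) <= E N.
  have wr : normc (r%:C * expi t) < rho.
    by rewrite Normc.normcM normc_expi mulr1 normc_real gtr0_norm.
  have xiE : r%:C * expi t / rho%:C = q%:C * expi t.
    rewrite mulrAC; congr (_ * _); apply: complexP; rewrite /q /=; field; rewrite gt_eqF//.
  have nq : normc (q%:C * expi t) = q.
    by rewrite Normc.normcM normc_expi mulr1 normc_real ger0_norm// ; case/andP: q01.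
  have q1 : normc (q%:C * expi t) < 1 by rewrite nq; case/andP: q01.
  have := cauchy_formula Hu rho01 wr; rewrite xiE circle_mean_cauchy_kernel// mulr1 => <-.
  by have := cauchy_kernel_expansion N mg gM q1; rewrite nq.
have mh := L2_cmeasurable Lh.
have ih : cintegrable h := L2_cintegrable Lh.
have ihX n : cintegrable (fun t => h t * expi t ^+ n).
  apply: cintegrable_dominated (L2_integrable_normc Lh) _.
    by apply: cmeasurableM => //; exact: cmeasurableX cmeasurable_expi.
  by move=> t _; rewrite Normc.normcM normc_exp normc_expi expr1n mulr1.
have hX n : circle_mean (fun t => h t * expi t ^+ n.+1) = 0.
  by rewrite -fourier_Negz; exact: h0.
apply/eqP; rewrite -subr_eq0; apply/eqP.
pose c := (2 * pi)^-1 * \int[mu]_(t in angles) normc (h t).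
apply: (@normc_eq0_geometric _ (2 * c * (2 * (M / (1 - q)))) q) => // N.
have iu : cintegrable (fun t => u (r%:C * expi t) * h t).
  apply: (@cintegrable_dominated _ _ (fun t => M * normc (h t))).
  - apply: cmeasurableM => //; apply: continuous_cmeasurable; apply: (continuous_circle Hu).
    by rewrite ltW.
  - exact: integrable_scale (L2_integrable_normc Lh).
  - move=> t _; rewrite Normc.normcM; apply: ler_wpM2r; first exact: normc_ge0.
    by apply: uM; apply: disc_circle; rewrite ltW.
pose Q n t := q%:C ^+ n * a n * (h t * expi t ^+ n).
have iQ n : cintegrable (Q n) by exact: cintegrableZ.
(* By [hX] only the term of index 0 contributes to the mean of the sum. *)
have -> : u 0 * circle_mean h = circle_mean (fun t => \sum_(0 <= n < N.+1) Q n t).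
  rewrite circle_mean_sum// big_nat_recl//= big1_seq => [|n _]; last first.
    by rewrite circle_meanZ// hX mulr0.
  rewrite addr0 circle_meanZ// expr0 mul1r a0; congr (_ * _).
  by apply: circle_mean_eq => t _; rewrite expr0 mulr1.
rewrite -[X in _ - X]mul1r -mulNr -circle_meanZ; last exact: cintegrable_sum.
rewrite -circle_meanD//; last by apply: cintegrableZ; exact: cintegrable_sum.
have -> : 2 * c * (2 * (M / (1 - q))) * q ^+ N.+1 =
    2 * ((2 * pi)^-1 * \int[mu]_(t in angles) (E N.+1 * normc (h t))).
  by rewrite RintegralZl /E /c//; [ring|exact: measurable_angles|exact: L2_integrable_normc].
apply: normc_circle_mean_le.
- apply: cintegrable_measurable; apply: cintegrableD => //.
  by apply: cintegrableZ; exact: cintegrable_sum.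
- exact: integrable_scale (L2_integrable_normc Lh).
- move=> t _.
  have -> : u (r%:C * expi t) * h t + -1 * (\sum_(0 <= n < N.+1) Q n t) =
     (u (r%:C * expi t) - \sum_(0 <= n < N.+1) (q%:C * expi t) ^+ n * a n) * h t.
    rewrite mulrBl mulN1r; congr (_ - _); rewrite mulr_suml; apply: eq_bigr => n _.
    by rewrite /Q exprMn; ring.
  by rewrite Normc.normcM; apply: ler_wpM2r; [exact: normc_ge0|exact: approx].
Qed.

End HardyMean.

(** * Boundary values *)

Section BoundaryValues.
Variable R : realType.
Implicit Types (w z : R[i]) (u du : R[i] -> R[i]) (t : R) (f g h : R -> R[i]).

Local Notation normc := (@Normc.normc R).
Local Notation Re := (@complex.Re R).
Local Notation Im := (@complex.Im R).
Local Notation mu := (@lebesgue_measure R).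
Local Notation angles := (@angles R).

Lemma dominated_Rintegral_cst (F_ : nat -> R -> R) (F G : R -> R) (k : R) :
  (forall n, measurable_fun angles (F_ n)) -> measurable_fun angles F ->
  {ae mu, forall t, angles t -> F_ n t @[n --> \oo] --> F t} ->
  mu.-integrable angles (EFin \o G) ->
  (forall n t, angles t -> `|F_ n t| <= G t) ->
  (forall n, \int[mu]_(t in angles) F_ n t = k) ->
  \int[mu]_(t in angles) F t = k.
Proof.
move=> mF_ mF cF iG FG Fk.
have h1 n : measurable_fun angles (EFin \o F_ n) by exact/measurable_EFinP.
have h2 : measurable_fun angles (EFin \o F) by exact/measurable_EFinP.
have h3 : {ae mu, forall t, angles t -> (EFin \o F_ n) t @[n --> \oo] --> (EFin \o F) t}.
  by apply: aeS cF => t cF tA; apply: cvg_EFin; [exact: nearW|exact: cF].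
have h4 : {ae mu, forall t n, angles t -> (`|(EFin \o F_ n) t| <= (EFin \o G) t)%E}.
  by apply: aeW => t n tA; rewrite lee_fin FG.
have [iF _ cvI] := @dominated_convergence _ _ _ mu _
  (@measurable_angles R) _ _ _ h1 h2 h3 iG h4.
have E n : (\int[mu]_(t in angles) (EFin \o F_ n) t)%E = k%:E.
  rewrite -(Fk n) /Rintegral fineK//.
  apply: integrable_fin_num => //; first exact: measurable_angles.
  apply: le_integrable iG; [exact: measurable_angles|exact: h1|].
  by move=> t tA; rewrite /= lee_fin (le_trans (FG n t tA)) ?ler_norm.
have : (fun n => \int[mu]_(t in angles) (EFin \o F_ n) t)%E @ \oo --> k%:E.
  by under eq_fun do rewrite E; exact: cvg_cst.
move=> cvk; rewrite /Rintegral -[k]/(fine k%:E); congr fine.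
exact: (cvg_unique _ cvI cvk).
Qed.

(** The denominator n + 2 keeps every radius strictly between 0 and 1, the first one included. *)
Let radius n : R := 1 - n.+2%:R^-1.

Let radius_gt0 n : 0 < radius n.
Proof. by rewrite /radius subr_gt0 invf_lt1 ?ltr1n. Qed.

Let radius_lt1 n : radius n < 1.
Proof. by rewrite /radius gtrBl invr_gt0. Qed.

Let cvg_radius : radius n @[n --> \oo] --> (1 : R).
Proof.
rewrite -[X in _ --> X]subr0; apply: cvgB; first exact: cvg_cst.
have := @cvg_harmonic R; rewrite -(@cvg_shiftS R^o (@harmonic R)); exact.
Qed.

(** Replaces [boundary u] by a Borel function of modulus 1 at every point, so that multiplication by
    it preserves [L2] and [inner] without exceptional sets. The mean identity passes to the limit
    along the radii, dominated by M |h|. *)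
Lemma boundary_representative u : inner_function u -> exists U : R -> R[i],
  [/\ cmeasurable U, forall t, normc (U t) = 1, ae_eq_circle U (boundary u) &
    forall h, H2 h -> circle_mean (fun t => U t * h t) = u 0 * circle_mean h].
Proof.
move=> [anu [M uM] uae].
have {}uM z : disc z -> normc (u z) <= M.
  by move=> /uM; rewrite lecR.
have [du Hu] := analytic_C1 anu.
pose v n t := u ((radius n)%:C * expi t).
have r01 n : 0 <= radius n < 1 by rewrite ltW//=.
have mv n : cmeasurable (v n).
  by apply: continuous_cmeasurable; exact: (continuous_circle Hu (r01 n)).
have vM n t : normc (v n t) <= M by apply: uM; exact: disc_circle.
have lim_ae : {ae mu, forall t, angles t -> [/\ normc (boundary u t) = 1,
    Re (v n t) @[n --> \oo] --> Re (boundary u t) &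
    Im (v n t) @[n --> \oo] --> Im (boundary u t)]}.
  apply: aeS uae => t H /H [w uw w1].
  have ub : radial_limit u t (boundary u t).
    by rewrite /boundary; apply: (@xgetPex _ _ [set w | radial_limit u t w]); exists w.
  have FF : ProperFilter (1 : R)^'- := at_left_proper_filter _.
  (* By uniqueness of limits, the value chosen by [boundary] is the limit of modulus 1. *)
  have wE : boundary u t = w.
    have /cvgcP [a1 a2] := ub; have /cvgcP [b1 b2] := uw.
    by apply: complexP; [exact: cvg_unique a1 b1|exact: cvg_unique a2 b2].
  have /cvgcP [a1 a2] := ub.
  split; first by rewrite wE; move: w1 => [].
    by move/cvg_at_leftP : a1; apply; split.
  by move/cvg_at_leftP : a2; apply; split.
(* [boundary u] itself need not be Borel, but it is a.e. equal to V. *)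
pose V t := fine (limn_esup (fun n => (Re (v n t))%:E)) +i*
            fine (limn_esup (fun n => (Im (v n t))%:E)).
have mV : cmeasurable V.
  have mfine (F : R -> \bar R) : measurable_fun angles F ->
      measurable_fun angles (fun t => fine (F t)).
    by apply: measurableT_comp; exact: fine_measurable.
  by split; apply: mfine; apply: measurable_fun_limn_esup => n;
    apply/measurable_EFinP; have [] := mv n.
have VE t : Re (v n t) @[n --> \oo] --> Re (boundary u t) ->
    Im (v n t) @[n --> \oo] --> Im (boundary u t) -> V t = boundary u t.
  move=> h1 h2; apply: complexP; rewrite /V /=.
    by have /cvg_limn_einf_sup [_ ->] : (Re (v n t))%:E @[n --> \oo] --> (Re (boundary u t))%:E
      by apply: cvg_EFin => //; exact: nearW.
  by have /cvg_limn_einf_sup [_ ->] : (Im (v n t))%:E @[n --> \oo] --> (Im (boundary u t))%:E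
      by apply: cvg_EFin => //; exact: nearW.
(* The default value 1 makes U unimodular at every point; on the circle it changes V on a null set
   only. *)
pose U t := if normc (V t) == 1 then V t else 1.
have mU : cmeasurable U.
  have mb : measurable_fun angles (fun t => normc (V t) == 1).
    apply: measurable_fun_eqr; [exact: cmeasurable_normc mV|exact: measurable_cst].
  have [mr mi] := mV.
  split.
    have -> : (fun t => Re (U t)) = (fun t => if normc (V t) == 1 then Re (V t) else 1).
      by apply/funext => t; rewrite /U; case: ifP.
    apply: measurable_fun_if => //; first exact: measurable_angles.
    by apply: measurable_funS mr => //; exact: measurable_angles.
  have -> : (fun t => Im (U t)) = (fun t => if normc (V t) == 1 then Im (V t) else 0).
    by apply/funext => t; rewrite /U; case: ifP.
  apply: measurable_fun_if => //; first exact: measurable_angles.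
  by apply: measurable_funS mi => //; exact: measurable_angles.
have U1 t : normc (U t) = 1.
  by rewrite /U; case: ifP => [/eqP//|_]; rewrite Normc.normc1.
have Uae : {ae mu, forall t, angles t -> [/\ U t = boundary u t,
    Re (v n t) @[n --> \oo] --> Re (U t) & Im (v n t) @[n --> \oo] --> Im (U t)]}.
  apply: aeS lim_ae => t H /H [b1 c1 c2].
  have UE : U t = boundary u t by rewrite /U VE// b1 eqxx.
  by rewrite UE.
exists U; split => //.
  by apply: aeS Uae => t H /H [].
move=> h Hh; have [Lh _] := Hh; have mh := L2_cmeasurable Lh.
have iG : mu.-integrable angles (EFin \o (fun t => M * normc (h t))).
  exact: integrable_scale (L2_integrable_normc Lh).
have vh n : circle_mean (fun t => v n t * h t) = u 0 * circle_mean h.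
  by apply: (circle_mean_radius_H2 Hu uM) => //; rewrite radius_gt0 radius_lt1.
have dom n t : normc (v n t * h t) <= M * normc (h t).
  by rewrite Normc.normcM ler_wpM2r ?normc_ge0.
have pi2 : 2 * pi != 0 :> R by rewrite gt_eqF ?twopi_gt0.
have meanE f (k : R[i]) : circle_mean f = k ->
   \int[mu]_(t in angles) Re (f t) = 2 * pi * Re k /\
   \int[mu]_(t in angles) Im (f t) = 2 * pi * Im k.
  by move=> <-; rewrite /circle_mean /= !mulrA mulfV// !mul1r.
set k := u 0 * circle_mean h.
have cvh t : Re (v n t) @[n --> \oo] --> Re (U t) -> Im (v n t) @[n --> \oo] --> Im (U t) ->
    (v n t * h t : R[i]^o) @[n --> \oo] --> (U t * h t : R[i]^o).
  by move=> c1 c2; apply: cvgM; [exact/cvgcP|exact: cvg_cst].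
have ERe : \int[mu]_(t in angles) Re (U t * h t) = 2 * pi * Re k.
  apply: (@dominated_Rintegral_cst (fun n t => Re (v n t * h t)) _ _ _ _ _ _ iG).
  - by move=> n; have [] := cmeasurableM (mv n) mh.
  - by have [] := cmeasurableM mU mh.
  - by apply: aeS Uae => t H /H [_ c1 c2]; have /cvgcP[] := cvh t c1 c2.
  - by move=> n t _; exact: le_trans (Re_le_normc _) (dom n t).
  - by move=> n; have [] := meanE _ _ (vh n).
have EIm : \int[mu]_(t in angles) Im (U t * h t) = 2 * pi * Im k.
  apply: (@dominated_Rintegral_cst (fun n t => Im (v n t * h t)) _ _ _ _ _ _ iG).
  - by move=> n; have [] := cmeasurableM (mv n) mh.
  - by have [] := cmeasurableM mU mh.
  - by apply: aeS Uae => t H /H [_ c1 c2]; have /cvgcP[] := cvh t c1 c2.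
  - by move=> n t _; exact: le_trans (Im_le_normc _) (dom n t).
  - by move=> n; have [] := meanE _ _ (vh n).
by apply: complexP; rewrite /circle_mean /= ?ERe ?EIm mulKf.
Qed.

End BoundaryValues.

(** * Inner products *)

Section Hilbert.
Variable R : realType.
Implicit Types (c : R[i]) (t : R) (f g h k : R -> R[i]) (S : set (R -> R[i])).

Local Notation normc := (@Normc.normc R).
Local Notation Re := (@complex.Re R).
Local Notation Im := (@complex.Im R).
Local Notation mu := (@lebesgue_measure R).
Local Notation angles := (@angles R).

Lemma mulcJ (c : R[i]) : c * c^* = (normc c ^+ 2)%:C.
Proof. by apply: complexP; rewrite normc_sqr; case: c => x y /=; ring. Qed.

Lemma normcJ c : normc c^* = normc c.
Proof. by case: c => x y; rewrite /= sqrrN. Qed.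

Lemma integrable_normc_sqr f : L2 f -> mu.-integrable angles (EFin \o (fun t => normc (f t) ^+ 2)).
Proof.
case=> _ _; rewrite (_ : (fun t => (_ + _)%:E) = EFin \o (fun t => normc (f t) ^+ 2))//.
by apply/funext => t /=; rewrite -normc_sqr.
Qed.

Lemma integrable_add (F G : R -> R) : mu.-integrable angles (EFin \o F) ->
  mu.-integrable angles (EFin \o G) ->
  mu.-integrable angles (EFin \o (fun t => F t + G t)).
Proof.
move=> iF iG.
have -> : EFin \o (fun t => F t + G t) = (fun t => (EFin \o F) t + (EFin \o G) t)%E.
  by apply/funext => t; rewrite /= EFinD.
by apply: integrableD => //; exact: measurable_angles.
Qed.

Lemma L2_dominated f (B : R -> R) : cmeasurable f ->
  mu.-integrable angles (EFin \o B) ->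
  (forall t, angles t -> normc (f t) ^+ 2 <= B t) -> L2 f.
Proof.
move=> mf iB fB; have [mr mi] := mf; split => //.
rewrite (_ : (fun t => (_ + _)%:E) = EFin \o (fun t => normc (f t) ^+ 2)); last first.
  by apply/funext => t /=; rewrite -normc_sqr.
apply: le_integrable iB; first exact: measurable_angles.
  by apply/measurable_EFinP; apply: measurable_funX; exact: cmeasurable_normc.
move=> t tA; rewrite /= lee_fin ger0_norm ?sqr_ge0//.
exact: le_trans (fB t tA) (ler_norm _).
Qed.

Lemma L2_bounded f (M : R) : cmeasurable f ->
  (forall t, angles t -> normc (f t) <= M) -> L2 f.
Proof.
move=> mf fM; apply: (L2_dominated mf (integrable_cst_angles (M ^+ 2))) => t /fM h.
by rewrite /= lerXn2r ?nnegrE ?normc_ge0// (le_trans (normc_ge0 _) h).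
Qed.

Lemma L2_unimodularM f g : cmeasurable f -> (forall t, normc (f t) = 1) -> L2 g ->
  L2 (fun t => f t * g t).
Proof.
move=> mf f1 Lg; apply: (L2_dominated _ (integrable_normc_sqr Lg)).
  by apply: cmeasurableM => //; exact: L2_cmeasurable.
by move=> t _; rewrite Normc.normcM f1 mul1r.
Qed.

Lemma cmeasurableZ c f : cmeasurable f -> cmeasurable (fun t => c * f t).
Proof. by move=> mf; apply: cmeasurableM => //; exact: cmeasurable_cst. Qed.

(** The shape f - c g is the one in which linearity of [L2], [H2] and [inner] is stated. Here |f - c
    g|^2 <= 2 |f|^2 + 2 |c|^2 |g|^2. *)
Lemma L2_combo c f g : L2 f -> L2 g -> L2 (fun t => f t - c * g t).
Proof.
move=> Lf Lg.
have iB : mu.-integrable angles (EFin \o (fun t => 2 * normc (f t) ^+ 2 +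
    (2 * normc c ^+ 2) * normc (g t) ^+ 2)).
  by apply: integrable_add; apply: integrable_scale; exact: integrable_normc_sqr.
apply: (L2_dominated _ iB) => [|t _].
  have := cmeasurableD (L2_cmeasurable Lf) (cmeasurableZ (- c) (L2_cmeasurable Lg)).
  by under eq_fun do rewrite mulNr.
have := normc_triangle (f t) (- (c * g t)); rewrite normc_opp Normc.normcM => h.
have : normc (f t - c * g t) ^+ 2 <= (normc (f t) + normc c * normc (g t)) ^+ 2.
  by rewrite lerXn2r ?nnegrE ?normc_ge0 ?addr_ge0 ?mulr_ge0 ?normc_ge0.
move=> /le_trans; apply.
have := sqr_ge0 (normc (f t) - normc c * normc (g t)); nra.
Qed.

Lemma L2_inner_cintegrable f g : L2 f -> L2 g -> cintegrable (fun t => f t * (g t)^*).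
Proof.
move=> Lf Lg.
have iB : mu.-integrable angles (EFin \o (fun t => normc (f t) ^+ 2 + normc (g t) ^+ 2)).
  by apply: integrable_add; exact: integrable_normc_sqr.
apply: (cintegrable_dominated _ iB) => [|t _].
  by apply: cmeasurableM; [|apply: cmeasurableJ]; exact: L2_cmeasurable.
rewrite Normc.normcM normcJ.
have := sqr_ge0 (normc (f t) - normc (g t)).
have := sqr_ge0 (normc (f t)); have := sqr_ge0 (normc (g t)); nra.
Qed.

Lemma inner_sym f g : L2 f -> L2 g -> inner g f = (inner f g)^*.
Proof.
move=> Lf Lg; rewrite !innerE -circle_meanJ; last exact: L2_inner_cintegrable.
by apply: circle_mean_eq => t _; rewrite rmorphM /= conjcK mulrC.
Qed.

Lemma inner_combol c f g h : L2 f -> L2 g -> L2 h ->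
  inner (fun t => f t - c * g t) h = inner f h - c * inner g h.
Proof.
move=> Lf Lg Lh; rewrite !innerE -mulNr -circle_meanZ; last exact: L2_inner_cintegrable.
rewrite -circle_meanD; first by apply: circle_mean_eq => t _; ring.
  exact: L2_inner_cintegrable.
by apply: cintegrableZ; exact: L2_inner_cintegrable.
Qed.

Lemma inner_combor c f g h : L2 f -> L2 g -> L2 h ->
  inner h (fun t => f t - c * g t) = inner h f - c^* * inner h g.
Proof.
move=> Lf Lg Lh; rewrite inner_sym//; last exact: L2_combo.
rewrite inner_combol// (inner_sym Lf Lh) (inner_sym Lg Lh).
by rewrite [LHS]rmorphB; congr (_ - _); exact: rmorphM.
Qed.

Lemma inner_self_ge0 f : 0 <= Re (inner f f).
Proof.
rewrite /inner /circle_mean /= mulr_ge0 ?invr_ge0 ?(ltW (twopi_gt0 R))//.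
apply: Rintegral_ge0 => t _; rewrite -[(_ * _)]/(f t * (f t)^*) mulcJ.
exact: sqr_ge0.
Qed.

Lemma l2norm_sqr f : l2norm f ^+ 2 = Re (inner f f).
Proof. by rewrite sqr_sqrtr// inner_self_ge0. Qed.

Lemma inner_unimodularM g f h : (forall t, normc (g t) = 1) ->
  inner (fun t => g t * f t) (fun t => g t * h t) = inner f h.
Proof.
move=> g1; rewrite !innerE; apply: circle_mean_eq => t _.
by rewrite rmorphM mulrACA /= mulcJ g1 expr1n mul1r.
Qed.

(** Since f - p is orthogonal to S, its products with f, f - p and f - q coincide, and likewise for
    f - q; so both squared norms are the real part of <f - p, f - q>. Hence the arbitrary choice
    made by [oproj] can be replaced by an explicit projection. *)
Lemma orthocomplement_proj_norm S f p q : L2 f -> S `<=` @L2 R -> S p -> S q ->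
  orthocomplement S (fun t => f t - p t) ->
  orthocomplement S (fun t => f t - q t) ->
  l2norm (fun t => f t - p t) = l2norm (fun t => f t - q t).
Proof.
move=> Lf SL Sp Sq [Lfp Hp] [Lfq Hq].
have B g : (fun t => f t - g t) = (fun t => f t - 1 * g t).
  by apply/funext => t; rewrite mul1r.
have E p' q' : L2 (fun t => f t - p' t) -> S q' ->
    inner (fun t => f t - p' t) q' = 0 ->
    inner (fun t => f t - p' t) (fun t => f t - q' t) = inner (fun t => f t - p' t) f.
  move=> L' /SL Lq' h; rewrite [in X in inner _ X]B inner_combor// h.
  by rewrite mulr0 subr0.
rewrite /l2norm (E p p)//; last exact: Hp.
rewrite -(E p q)//; last exact: Hp.
rewrite (inner_sym Lfq Lfp) (E q p)//; last exact: Hq.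
by rewrite -(E q q)// ?ReJ//; exact: Hq.
Qed.

Lemma L2_expiJ : L2 (fun t => conjc (expi t)).
Proof.
apply: (@L2_bounded _ 1); first exact: cmeasurableJ (cmeasurable_expi R).
by move=> t _; rewrite normcJ normc_expi.
Qed.

Lemma inner_expiJ :
  inner (fun t => conjc (expi t)) (fun t => conjc (expi t)) = 1.
Proof.
rewrite innerE -[RHS](circle_mean_cst (1 : R[i])); apply: circle_mean_eq => t _.
by rewrite conjcK mulrC expiJ.
Qed.

Lemma l2norm_expiJ : l2norm (fun t => conjc (expi t)) = 1.
Proof.
by apply/eqP; rewrite -(@eqrXn2 _ 2)// ?sqrtr_ge0// l2norm_sqr expr1n inner_expiJ.
Qed.

(** * Membership in H^2, forward and backward shift *)

Lemma H2P f : H2 f <-> L2 f /\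
  forall n, circle_mean (fun t => f t * expi t ^+ n.+1) = 0.
Proof.
split=> -[Lf Hf]; split => //.
  by move=> n; rewrite -fourier_Negz; exact: Hf.
by case=> // n _; rewrite fourier_Negz.
Qed.

Lemma cintegrable_expiXM f n : L2 f -> cintegrable (fun t => f t * expi t ^+ n).
Proof.
move=> Lf; apply: cintegrable_dominated (L2_integrable_normc Lf) _.
  by apply: cmeasurableM; [exact: L2_cmeasurable|exact: cmeasurableX (cmeasurable_expi R)].
by move=> t _; rewrite Normc.normcM normc_exp normc_expi expr1n mulr1.
Qed.

Lemma circle_mean_combo c f g : cintegrable f -> cintegrable g ->
  circle_mean (fun t => f t - c * g t) = circle_mean f - c * circle_mean g.
Proof.
move=> If Ig; rewrite -mulNr -circle_meanZ// -circle_meanD//.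
  by apply: circle_mean_eq => t _; rewrite mulNr.
exact: cintegrableZ.
Qed.

Lemma H2_combo c f g : H2 f -> H2 g -> H2 (fun t => f t - c * g t).
Proof.
move=> /H2P [Lf Hf] /H2P [Lg Hg]; apply/H2P; split; first exact: L2_combo.
move=> n.
under circle_mean_eq do rewrite mulrBl -mulrA.
rewrite circle_mean_combo; [|exact: cintegrable_expiXM..].
by rewrite Hf Hg mulr0 subr0.
Qed.

Lemma L2_one : L2 (fun=> 1 : R[i]).
Proof.
by apply: (@L2_bounded _ 1); [exact: cmeasurable_cst|move=> t _; rewrite Normc.normc1].
Qed.

Lemma H2_one : H2 (fun=> 1 : R[i]).
Proof.
apply/H2P; split; first exact: L2_one.
by move=> n; under circle_mean_eq do rewrite mul1r; exact: circle_mean_expiX.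
Qed.

Lemma H2_expiM f : H2 f -> H2 (fun t => expi t * f t).
Proof.
move=> /H2P [Lf Hf]; apply/H2P; split.
  by apply: L2_unimodularM => //; [exact: cmeasurable_expi|exact: normc_expi].
by move=> n; rewrite -(Hf n.+1); apply: circle_mean_eq => t _; rewrite mulrAC -exprS mulrC.
Qed.

Lemma circle_mean_H2_expiM f : H2 f -> circle_mean (fun t => expi t * f t) = 0.
Proof.
by move=> /H2P [Lf Hf]; rewrite -(Hf 0%N); apply: circle_mean_eq => t _; rewrite expr1 mulrC.
Qed.

Lemma H2_expiX n : H2 (fun t => expi t ^+ n : R[i]).
Proof.
elim: n => [|n IH]; first exact: H2_one.
by under eq_fun do rewrite exprS; exact: H2_expiM.
Qed.

(** Once the constant term is removed, division by e^{it} stays in H^2. The factor 1 is kept to have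
    the shape f - c g. *)
Lemma backward_shift_H2 f : H2 f ->
  H2 (fun t => (expi t)^* * (f t - circle_mean f * 1)).
Proof.
move=> /[dup] Hf /H2P [Lf f0]; apply/H2P; split.
  apply: L2_unimodularM; first exact: cmeasurableJ (cmeasurable_expi R).
    by move=> t; rewrite normcJ normc_expi.
  by apply: L2_combo => //; exact: L2_one.
move=> n.
under circle_mean_eq => t do rewrite mulrAC exprS mulrA [(expi t)^* * _]mulrC expiJ mul1r
  mulrC mulrBl -mulrA mul1r.
rewrite circle_mean_combo; last 2 first.
- exact: cintegrable_expiXM.
- by have := cintegrable_expiXM n L2_one; under eq_fun do rewrite mul1r.
(* The case n = 0 is the Fourier coefficient of index -1, made zero by subtracting the mean. *)
case: n => [|n]; last by rewrite f0 circle_mean_expiX mulr0 subr0.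
under circle_mean_eq do rewrite expr0 mulr1.
under [X in _ - _ * X]circle_mean_eq do rewrite expr0.
by rewrite circle_mean_cst mulr1 subrr.
Qed.

End Hilbert.

(** * The dual compressed shift *)

Section MinimumModulus.
Variable R : realType.
Variables (u : R[i] -> R[i]) (U : R -> R[i]).

Local Notation normc := (@Normc.normc R).
Local Notation Re := (@complex.Re R).
Local Notation Im := (@complex.Im R).
Local Notation mu := (@lebesgue_measure R).
Local Notation angles := (@angles R).
Local Notation K := (model_space u).
Local Notation z := (@expi R).
Local Notation zbar := (fun t : R => conjc (expi t)).
Local Notation a := (u 0).

Hypothesis mU : cmeasurable U.
Hypothesis normcU : forall t, normc (U t) = 1.
Hypothesis U_boundary : ae_eq_circle U (boundary u).
Hypothesis meanUM : forall h, H2 h ->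
  circle_mean (fun t => U t * h t) = a * circle_mean h.

(** The reproducing kernel of the model space at the origin, as [inner_k0] shows. *)
Let k0 : R -> R[i] := fun t => 1 - conjc a * U t.

Let L2_U : L2 U.
Proof. by apply: (@L2_bounded _ _ 1) => // t _; rewrite normcU. Qed.

Let L2_UM h : H2 h -> L2 (fun t => U t * h t).
Proof. by case=> Lh _; exact: L2_unimodularM. Qed.

Let uH2_UM h : H2 h -> uH2 u (fun t => U t * h t).
Proof.
move=> Hh; split; first exact: L2_UM.
by exists h => //; apply: aeS U_boundary => t E /E ->.
Qed.

(** [uH2] is defined through [boundary u]; as means ignore null sets, testing on the products U h is
    enough. *)
Let orthocomplement_uH2 g : L2 g ->
  (forall h, H2 h -> inner g (fun t => U t * h t) = 0) -> orthocomplement (uH2 u) g.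
Proof.
move=> Lg gU; split => // f [Lf [h Hh fh]]; rewrite -(gU h Hh) !innerE.
have mg := L2_cmeasurable Lg.
apply: circle_mean_ae.
- by apply: cmeasurableM => //; apply: cmeasurableJ; exact: L2_cmeasurable.
- by apply: cmeasurableM => //; apply: cmeasurableJ; apply: L2_cmeasurable; exact: L2_UM.
- have /(_ _ _ U_boundary fh) := @filterI _ _ (ae_filter_ringOfSetsType mu).
  by apply: aeS => t [E1 E2] tA; rewrite E2// E1.
Qed.

Let circle_meanU : circle_mean U = a.
Proof.
have := meanUM (H2_one R); rewrite circle_mean_cst mulr1 => <-.
by apply: circle_mean_eq => t _; rewrite mulr1.
Qed.

Let H2_U : H2 U.
Proof.
apply/H2P; split => // n.
by rewrite meanUM; [rewrite circle_mean_expiX mulr0|exact: H2_expiX].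
Qed.

Let L2_K k : K k -> L2 k. Proof. by case=> -[]. Qed.

Let innerU k : K k -> inner U k = 0.
Proof.
move=> Kk; have [_ [Lk kU]] := Kk.
rewrite inner_sym//; have := kU _ (uH2_UM (H2_one R)).
by under eq_fun do rewrite mulr1; move=> ->; rewrite [LHS]rmorph0.
Qed.

Let inner1 (f : R -> R[i]) : L2 f -> inner (fun _ : R => 1) f = conjc (circle_mean f).
Proof.
move=> Lf; rewrite innerE -circle_meanJ; last exact: L2_cintegrable.
by apply: circle_mean_eq => t _; rewrite mul1r.
Qed.

(** For h in H^2, <1, U h> = conj(a mean(h)), while <U, U h> = <1, h> = conj(mean(h)) because |U| =
    1; the two contributions cancel. *)
Let model_space_k0 : K k0.
Proof.
have Hk0 : H2 k0 by apply: H2_combo; [exact: H2_one|exact: H2_U].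
split => //; apply: orthocomplement_uH2; first by case: Hk0.
move=> h Hh; have [Lh _] := Hh.
rewrite inner_combol//; [|exact: L2_one|exact: L2_UM].
rewrite inner1; last exact: L2_UM.
have -> : inner U (fun t => U t * h t) = conjc (circle_mean h).
  have U1 : (fun t => U t * 1) = U by apply/funext => t; rewrite mulr1.
  by rewrite -inner1// -(inner_unimodularM (fun=> 1) h normcU) U1.
by rewrite meanUM// [conjc (_ * _)]rmorphM subrr.
Qed.

Let inner_k0 k : K k -> inner k0 k = conjc (circle_mean k).
Proof.
move=> Kk; have Lk := L2_K Kk.
rewrite inner_combol//; last exact: L2_one.
by rewrite innerU// mulr0 subr0 inner1.
Qed.

(** Multiplying both sides by e^{it} turns the product with U h into one of k - mean(k) with U z h:
    k is orthogonal to it, and U z h has mean a mean(z h) = 0. *)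
Let backward_shift_model_space k : K k ->
  K (fun t => zbar t * (k t - circle_mean k * 1)).
Proof.
move=> Kk; have [Hk [Lk kU]] := Kk.
have Hs := backward_shift_H2 Hk; split => //.
apply: orthocomplement_uH2; first by case: Hs.
move=> h Hh; have Hzh := H2_expiM Hh.
rewrite -(inner_unimodularM _ _ (@normc_expi R)).
have -> : (fun t => expi t * (zbar t * (k t - circle_mean k * 1))) =
    (fun t => k t - circle_mean k * 1).
  by apply/funext => t; rewrite mulrA expiJ mul1r.
have -> : (fun t => expi t * (U t * h t)) = (fun t => U t * (expi t * h t)).
  by apply/funext => t; rewrite mulrCA.
rewrite inner_combol//; [|exact: L2_one|exact: L2_UM].
rewrite kU; last exact: uH2_UM.
rewrite inner1; last exact: L2_UM.
by rewrite meanUM// circle_mean_H2_expiM// mulr0 [conjc 0]rmorph0 mulr0 subr0.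
Qed.

(** * Image of a vector under the dual compressed shift *)

Section Perp.
Variable f : R -> R[i].
Hypothesis Vf : model_space_perp u f.

Let c := circle_mean (fun t => z t * f t).

Let Lf : L2 f. Proof. by case: Vf. Qed.

Let Lzf : L2 (fun t => z t * f t).
Proof. by apply: L2_unimodularM => //; [exact: cmeasurable_expi|exact: normc_expi]. Qed.

(** Orthogonality of f to the backward shift of k says that z f is orthogonal to k - mean(k), so
    only the constant part of k counts. *)
Let inner_zf k : K k -> inner (fun t => z t * f t) k = c * conjc (circle_mean k).
Proof.
move=> Kk; have Lk := L2_K Kk; have [_ Vf'] := Vf.
have := Vf' _ (backward_shift_model_space Kk).
rewrite -(inner_unimodularM _ _ (@normc_expi R)).
have -> : (fun t => expi t * (zbar t * (k t - circle_mean k * 1))) =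
    (fun t => k t - circle_mean k * 1).
  by apply/funext => t; rewrite mulrA expiJ mul1r.
rewrite inner_combor//; last exact: L2_one.
move/eqP; rewrite subr_eq0 => /eqP ->; rewrite mulrC; congr (_ * _).
rewrite innerE; apply: circle_mean_eq => t _.
by rewrite [conjc 1]rmorph1 mulr1.
Qed.

(** Both z f and c k0 pair with k to c conj(mean(k)); with [K_ck0], this makes c k0 a projection of
    z f onto the model space. *)
Let proj_k0 : orthocomplement K (fun t => z t * f t - c * k0 t).
Proof.
have Lk0 := L2_K model_space_k0.
split; first exact: L2_combo.
move=> k Kk; have Lk := L2_K Kk.
by rewrite inner_combol// inner_zf// inner_k0// subrr.
Qed.

Let K_ck0 : K (fun t => c * k0 t).
Proof.
have [Hk0 [Lk0 Ok0]] := model_space_k0.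
(* The multiple is rewritten in the shape f - c g, with the zero function obtained as k0 - 1 k0. *)
have E : (fun t => c * k0 t) = (fun t => 0 * k0 t - (- c) * k0 t).
  by apply/funext => t; rewrite mul0r sub0r mulNr opprK.
have E0 : (fun t => 0 * k0 t) = (fun t => k0 t - 1 * k0 t).
  by apply/funext => t; rewrite mul0r mul1r subrr.
have H0 : H2 (fun t => 0 * k0 t) by rewrite E0; exact: H2_combo.
split; rewrite E; first exact: H2_combo.
split; first by apply: L2_combo => //; case: H0.
move=> g gu; have Lg : L2 g by case: gu.
rewrite inner_combol//; last by case: H0.
rewrite E0 inner_combol// (Ok0 g gu); ring.
Qed.

(** Pythagoras for z f = c k0 + D_u f. The factor 1 - |a|^2 is mean(k0), which is also the squared
    norm of k0. *)
Lemma l2norm_dual_shift_sqr :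
  l2norm (dual_compressed_shift u f) ^+ 2 =
  l2norm f ^+ 2 - normc c ^+ 2 * (1 - normc a ^+ 2).
Proof.
have Lk0 := L2_K model_space_k0.
have LK : K `<=` @L2 R by move=> k; exact: L2_K.
have [Kp Op] : [set p | K p /\ orthocomplement K (fun t => z t * f t - p t)]
    (oproj K (fun t => z t * f t)).
  by apply: xgetPex; exists (fun t => c * k0 t).
rewrite /dual_compressed_shift.
rewrite (orthocomplement_proj_norm Lzf LK Kp K_ck0 Op proj_k0) !l2norm_sqr.
have [Lw Ow] := proj_k0.
(* The residual is orthogonal to k0, so its squared norm is its product with z f. *)
rewrite {2}/k0 -/k0 inner_combor// (Ow _ model_space_k0) mulr0 subr0.
rewrite inner_combol// (inner_unimodularM _ _ (@normc_expi R)).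
rewrite (inner_sym Lzf Lk0) (inner_zf model_space_k0).
have -> : circle_mean k0 = (1 - normc a ^+ 2)%:C.
  rewrite /k0 circle_mean_combo; [|exact: cintegrable_cst|exact: L2_cintegrable].
  rewrite circle_mean_cst circle_meanU mulrC rmorphB rmorph1; congr (_ - _).
  exact: mulcJ.
rewrite ReB; congr (_ - _); rewrite -[normc c ^+ 2]/(Re (normc c ^+ 2)%:C) -mulcJ.
rewrite normc_sqr; case: (c) => x y /=; ring.
Qed.

(** Bessel's inequality for the unit vector conj z: c = <f, conj z>, and the squared norm of f - c
    conj z is |f|^2 - |c|^2. *)
Lemma normc_mean_zM_le : normc c ^+ 2 <= l2norm f ^+ 2.
Proof.
have Lzb := L2_expiJ R.
have cE : inner f zbar = c.
  by rewrite innerE; apply: circle_mean_eq => t _; rewrite conjcK mulrC.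
have := inner_self_ge0 (fun t => f t - c * zbar t).
rewrite inner_combor//; last exact: L2_combo.
rewrite !inner_combol// (inner_sym Lf Lzb) cE inner_expiJ l2norm_sqr ReB normc_sqr.
rewrite !ReB !ReM; case: (c) => x y /=; nra.
Qed.

End Perp.

(** The product of k in H^2 with conj z is its Fourier coefficient of index -1. *)
Lemma zbar_model_space_perp : model_space_perp u zbar.
Proof.
have Lzb := L2_expiJ R.
split => // k Kk; have [[Lk Hk] _] := Kk.
rewrite inner_sym// innerE.
have -> : circle_mean (fun t => k t * conjc (zbar t)) = 0.
  by rewrite -(Hk (Negz 0) isT) fourier_Negz; apply: circle_mean_eq => t _; rewrite conjcK.
by rewrite [LHS]rmorph0.
Qed.

(** As |c| <= 1, the squared norm 1 - |c|^2 (1 - |a|^2) is at least |a|^2. *)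
Lemma l2norm_dual_shift_ge f : model_space_perp u f -> l2norm f = 1 ->
  normc a <= l2norm (dual_compressed_shift u f).
Proof.
move=> Vf f1; rewrite -(@ler_pXn2r _ 2) ?nnegrE ?normc_ge0 ?sqrtr_ge0//.
rewrite (l2norm_dual_shift_sqr Vf).
have := normc_mean_zM_le Vf; rewrite f1 expr1n.
(* This quantity is the squared norm of k0. *)
have : 0 <= 1 - normc a ^+ 2.
  have := inner_self_ge0 k0; rewrite (inner_k0 model_space_k0).
  rewrite /k0 circle_mean_combo; [|exact: cintegrable_cst|exact: L2_cintegrable].
  rewrite circle_mean_cst circle_meanU normc_sqr; case: (a) => x y /=; nra.
nra.
Qed.

(** For f = conj z the coefficient c is the mean of z conj z = 1, so the lower bound is reached. *)
Lemma l2norm_dual_shift_zbar : l2norm (dual_compressed_shift u zbar) = normc a.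
Proof.
apply/eqP; rewrite -(@eqrXn2 _ 2) ?sqrtr_ge0 ?normc_ge0//.
rewrite (l2norm_dual_shift_sqr zbar_model_space_perp) l2norm_expiJ.
have -> : circle_mean (fun t => z t * zbar t) = 1.
  rewrite -[RHS](circle_mean_cst (1 : R[i])); apply: circle_mean_eq => t _.
  exact: expiJ.
by rewrite Normc.normc1; apply/eqP; ring.
Qed.

End MinimumModulus.

Theorem theorem3p8 (R : realType) (u : R[i] -> R[i])
  (u_inner : inner_function u) (u_nonconstant : nonconstant u) :
  (min_modulus (model_space_perp u) (dual_compressed_shift u))%:C
    = (if u 0 == 0 then 0 else `|u 0|)
  /\ attains_min_modulus (model_space_perp u) (dual_compressed_shift u).
Proof.
have [U [mU U1 Ub meanU]] := boundary_representative u_inner.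
have Vzb := zbar_model_space_perp u.
have zb := l2norm_dual_shift_zbar mU U1 Ub meanU.
have mE : min_modulus (model_space_perp u) (dual_compressed_shift u) = Normc.normc (u 0).
  (* The unit vector conj z gives the upper bound and shows that the set of norms is nonempty;
     [l2norm_dual_shift_ge] gives the lower bound. *)
  apply/eqP; rewrite eq_le; apply/andP; split.
    apply: ge_inf; last first.
      by exists (fun t => conjc (expi t)) => //; split => //; exact: l2norm_expiJ.
    by exists 0 => _ [f _ <-]; exact: sqrtr_ge0.
  apply: lb_le_inf.
    by eexists; exists (fun t => conjc (expi t)) => //; split => //; exact: l2norm_expiJ.
  by move=> _ [f [Vf f1] <-]; exact: (l2norm_dual_shift_ge mU U1 Ub meanU).
(* Both cases of the formula are |u(0)|, which is 0 when u(0) = 0. *)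
split; first by rewrite mE; case: eqP => [->|_]; rewrite ?Normc.normc0.
exists (fun t => conjc (expi t)); split => //; first exact: l2norm_expiJ.
by rewrite mE.
Qed.
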